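(* Let $(u^\epsilon,m^\epsilon)$ be a solution of the regularized mean-field game system described in the context, and suppose $m^\epsilon\in L^\infty([0,T],L^{\beta_0}(\mathbb{T}^d))$ for some $\beta_0\ge1$. Let $p>\frac d2$, let $q$ be the conjugate exponent of $p$ ($\frac1p+\frac1q=1$), let $\theta>1$, and set $$\kappa=\frac{d+2q-dq}{q[(\theta-1)d+2]},\qquad r=\frac1\kappa,\qquad \beta_n=\theta^n\beta_0,\qquad r_n=r\,\frac{\theta^n-1}{\theta-1}.$$ Then for every $n\ge1$ there is a constant $C$ such that for all $\tau\in[0,T]$ $$\int_{\mathbb{T}^d}(m^\epsilon)^{\beta_n}(\tau,x)\,dx\le C+C\left\|\,|D_pH|^2\right\|_{L^r(0,T;L^p(\mathbb{T}^d))}^{r_n}.$$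
   Context: $\mathbb{T}^d$ is the $d$-dimensional flat torus, $d>2$, $T>0$ fixed, $D=D_x$ the spatial gradient. $H:\mathbb{T}^d\times\mathbb{R}^d\to\mathbb{R}$ is smooth, strictly convex in $p$, with $\lim_{|p|\to\infty}H(x,p)/|p|=+\infty$ and $H\ge1$; $u_0,m_0\in C^\infty(\mathbb{T}^d)$, $m_0\ge0$, $\int_{\mathbb{T}^d}m_0=1$; $g:[0,\infty)\to\mathbb{R}$. For $\epsilon>0$, $\eta_\epsilon$ is a standard symmetric mollifying kernel and $g_\epsilon(m)=\eta_\epsilon*g(\eta_\epsilon*m)$. A solution $(u^\epsilon,m^\epsilon)$ is a classical (smooth) solution on $\mathbb{T}^d\times[0,T]$ of $$-u^\epsilon_t+H(x,Du^\epsilon)=\Delta u^\epsilon+g_\epsilon(m^\epsilon),\qquad m^\epsilon_t-\operatorname{div}(D_pH(x,Du^\epsilon)m^\epsilon)=\Delta m^\epsilon,$$ with $u^\epsilon(x,T)=u_0(x)$, $m^\epsilon(x,0)=m_0(x)$. $D_pH$ is evaluated at $(x,Du^\epsilon(x,t))$. The constant $C$ may depend on $n,d,T,p,\theta,\beta_0,m_0$ and on the bound for $\|m^\epsilon\|_{L^\infty([0,T],L^{\beta_0})}$, but not otherwise on $\epsilon$ or the solution. *)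

(* Defs.v *)
From HB Require Import structures.
From mathcomp Require Import all_boot all_order all_algebra.
From mathcomp Require Import all_classical all_reals all_analysis.

Set Implicit Arguments.
Unset Strict Implicit.
Unset Printing Implicit Defensive.
Import Order.TTheory GRing.Theory Num.Theory.
Import numFieldNormedType.Exports.

Local Open Scope classical_set_scope.
Local Open Scope ring_scope.

Section tuple_measure.
Context {d : measure_display} {T : measurableType d} {R : realType}.

Definition tcons n (z : T * n.-tuple T) : n.+1.-tuple T :=
  [tuple of z.1 :: z.2].

Lemma measurable_tcons n :
  measurable_fun [set: (T * n.-tuple T)%type] (@tcons n).
Proof. exact: measurable_cons. Qed.

HB.instance Definition _ n :=
  @isMeasurableFun.Build _ _ _ _ (@tcons n) (@measurable_tcons n).

Section tcons_measure.
Context {n : nat} (mu : {sigma_finite_measure set T -> \bar R})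
  (nu : {sigma_finite_measure set (n.-tuple T) -> \bar R}).

Definition tcons_measure : set (n.+1.-tuple T) -> \bar R :=
  pushforward (mu \x nu)%E ((@tcons n) : {mfun (T * n.-tuple T)%type >-> _}).

Let tcons_measure0 : tcons_measure set0 = 0%E.
Proof. exact: measure0. Qed.

Let tcons_measure_ge0 A : (0 <= tcons_measure A)%E.
Proof. exact: measure_ge0. Qed.

Let tcons_measure_sigma_additive : semi_sigma_additive tcons_measure.
Proof. exact: measure_semi_sigma_additive. Qed.

HB.instance Definition _ := isMeasure.Build _ _ _ tcons_measure
  tcons_measure0 tcons_measure_ge0 tcons_measure_sigma_additive.

Let sigma_finite_tcons_measure : sigma_finite setT tcons_measure.
Proof.
have /sigma_finiteP[F [FT ndF Foo]] := sigma_finiteT mu.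
have /sigma_finiteP[G [GT ndG Goo]] := sigma_finiteT nu.
pose s (t : n.+1.-tuple T) : T * n.-tuple T := (thead t, [tuple of behead t]).
have sK z : s (tcons z) = z by case: z => x t; congr pair; exact/val_inj.
have ms : measurable_fun [set: n.+1.-tuple T] s.
  by apply: measurable_fun_pair; [exact: measurable_tnth|
                                  exact: measurable_behead].
exists (fun k => s @^-1` (F k `*` G k)).
  rewrite -preimage_bigcup (_ : \bigcup_k _ = setT) ?preimage_setT//.
  rewrite -setXTT FT GT predeqE => -[x y]; split=> [[k _ [? ?]]|].
    by split; exists k.
  move=> [/= [i _ Fx] [j _ Gy]]; exists (maxn i j) => //; split.
  - by move: x Fx; exact/subsetPset/ndF/leq_maxl.
  - by move: y Gy; exact/subsetPset/ndG/leq_maxr.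
move=> k; have [mF Fk] := Foo k; have [mG Gk] := Goo k; split.
  by rewrite -[X in measurable X]setTI; apply: ms => //; exact: measurableX.
rewrite /tcons_measure /pushforward -comp_preimage.
rewrite (_ : s \o _ = id); last by apply/funext => z; exact: sK.
by rewrite preimage_id product_measure1E// lte_mul_pinfty// ge0_fin_numE.
Qed.

HB.instance Definition _ := Measure_isSigmaFinite.Build _ _ _
  tcons_measure sigma_finite_tcons_measure.

End tcons_measure.

Fixpoint power_measure (mu : {sigma_finite_measure set T -> \bar R}) (n : nat) :
    {sigma_finite_measure set (n.-tuple T) -> \bar R} :=
  match n with
  | 0 => \d_[tuple]
  | n'.+1 => tcons_measure mu (power_measure mu n')
  end.

End tuple_measure.

Section lebesgue.
Context {R : realType}.

Lemma lebesgue_itv_lty (a b : R) : (@lebesgue_measure R `[a, b] < +oo)%E.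
Proof. by rewrite lebesgue_measure_itv; case: ifPn => _; rewrite ?ltry. Qed.

Definition lebesgue_itv (a b : R) : {finite_measure set (measurableTypeR R) -> \bar R} :=
  @mfrestr _ (measurableTypeR R) R `[a, b]%classic lebesgue_measure
    (measurable_itv `[a, b]) (lebesgue_itv_lty a b).

(* Points of R^d are row vectors, which carry the normed structure; the product
   sigma-algebra lives on tuples, so integrals over R^d are taken through
   [vec]. *)
Definition vec d (x : d.-tuple R) : 'rV[R]_d := \row_i tnth x i.

Definition lebesgue_space d := power_measure (@lebesgue_measure R) d.

(* The flat torus is R^d / Z^d: functions on it are the Z^d-periodic functions
   on R^d, integrated over the fundamental domain [0, 1]^d. *)
Definition torus_measure d := power_measure (lebesgue_itv 0 1) d.

Definition zperiodic d (f : 'rV[R]_d -> R) :=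
  forall (i : 'I_d) (x : 'rV[R]_d), f (x + delta_mx 0 i) = f x.

(* The norm of L^a(0, T; L^b(T^d)). *)
Definition LtLx d (T : R) (a b : \bar R) (f : 'rV[R]_d -> R -> R) : \bar R :=
  Lnorm (lebesgue_itv 0 T) a
    (fun t => Lnorm (torus_measure d) b (fun x => (f (vec x) t)%:E)).

End lebesgue.

Section calculus.
Context {R : realType}.

(* C^oo: all iterated directional derivatives exist and are differentiable. *)
Definition smooth (V : normedModType R) (f : V -> R) :=
  forall (vs : seq V) (x : V),
    differentiable (foldr (fun v g => 'D_v g : V -> R) f vs) x.

(* Smoothness on R^d x [0, T] up to the boundary times 0 and T. *)
Definition smooth_upto d (T : R) (f : 'rV[R]_d -> R -> R) :=
  exists2 F : 'rV[R]_d * R -> R, smooth F &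
    forall x t, 0 <= t <= T -> F (x, t) = f x t.

Definition grad d (f : 'rV[R]_d -> R) (x : 'rV[R]_d) : 'rV[R]_d :=
  \row_i 'D_(delta_mx 0 i) f x.

Definition divergence d (F : 'rV[R]_d -> 'rV[R]_d) (x : 'rV[R]_d) : R :=
  \sum_i 'D_(delta_mx 0 i) (fun y => F y 0 i) x.

Definition laplacian d (f : 'rV[R]_d -> R) : 'rV[R]_d -> R :=
  divergence (grad f).

(* The norm [`|v|] of the library is the maximum norm. *)
Definition enorm d (v : 'rV[R]_d) : R := Num.sqrt (\sum_i v 0 i ^+ 2).

End calculus.

Section mean_field_game.
Context {R : realType} {d : nat}.
Local Notation V := 'rV[R]_d.

Record hamiltonian (H : V -> V -> R) : Prop := {
  hamiltonian_periodic : forall p, zperiodic (H ^~ p);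
  hamiltonian_smooth : smooth (fun z : V * V => H z.1 z.2);
  hamiltonian_strictly_convex : forall x p q (s : R), p != q -> 0 < s < 1 ->
    H x (s *: p + (1 - s) *: q) < s * H x p + (1 - s) * H x q;
  hamiltonian_superlinear : forall x (A : R), exists B : R,
    forall p, B < enorm p -> A < H x p / enorm p;
  hamiltonian_ge1 : forall x p, 1 <= H x p }.

Definition DpH (H : V -> V -> R) (u : V -> R -> R) (x : V) (t : R) : V :=
  grad (H x) (grad (u ^~ t) x).

Record mollifier (eta : V -> R) : Prop := {
  mollifier_smooth : smooth eta;
  mollifier_ge0 : forall y, 0 <= eta y;
  mollifier_support : forall y, 1 <= enorm y -> eta y = 0;
  mollifier_even : forall y, eta (- y) = eta y;
  mollifier_integral : (\int[lebesgue_space d]_y (eta (vec y))%:E = 1)%E }.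

Definition rescale (eta : V -> R) (eps : R) (y : V) : R :=
  eps ^- d * eta (eps^-1 *: y).

Definition conv (k f : V -> R) (x : V) : R :=
  \int[lebesgue_space d]_y (k (vec y) * f (x - vec y)).

(* Only the values of g on [0, +oo) matter: m >= 0 and eta >= 0. *)
Definition reg_coupling (eta : V -> R) (eps : R) (g : R -> R) (m : V -> R) :
    V -> R :=
  conv (rescale eta eps) (g \o conv (rescale eta eps) m).

(* The equations are stated at interior times, where the two-sided time
   derivative only depends on the values on [0, T]; by smoothness up to the
   boundary they extend to t = 0 and t = T by continuity. *)
Record mfg_solution (T : R) (H : V -> V -> R) (u0 m0 : V -> R)
    (geps : (V -> R) -> V -> R) (u m : V -> R -> R) : Prop := {
  mfg_periodic : forall t : R, 0 <= t <= T ->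
    zperiodic (u ^~ t) /\ zperiodic (m ^~ t);
  mfg_smooth : smooth_upto T u /\ smooth_upto T m;
  mfg_hamilton_jacobi : forall x t, 0 < t < T ->
    - derive1 (u x) t + H x (grad (u ^~ t) x)
      = laplacian (u ^~ t) x + geps (m ^~ t) x;
  mfg_fokker_planck : forall x t, 0 < t < T ->
    derive1 (m x) t - divergence (fun y => m y t *: DpH H u y t) x
      = laplacian (m ^~ t) x;
  mfg_terminal : forall x, u x T = u0 x;
  mfg_initial : forall x, m x 0 = m0 x }.

End mean_field_game.

(* Main.v *)
(** Testing the Fokker-Planck equation with [phi'(m)], where
    [phi(s) = (s^2 + 1)^(beta/2)] and [beta = theta^(k+1) beta0], and integrating
    by parts gives, for [w = (m^2 + 1)^(beta/4)],
      [d/dt \int w^2 + c \int |Dw|^2 <= C \int w^2 |DpH|^2].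
    Replacing [m] by [(m^2 + 1)^(1/2)] makes [w] smooth and at least 1 without
    any information on the sign or the zeros of [m].  Hoelder's inequality bounds
    the right-hand side by [B(t) (\int w^(2q))^(1/q)] with [B = || |DpH|^2 ||_p], and
    the Gagliardo-Nirenberg inequality between [L^(2/theta)] and [H^1], with
    exponents [kappa] and [1 - kappa], followed by Young's inequality, absorbs the
    gradient and leaves [C (1 + B(t)^r) (\int w^(2/theta))^theta], where
    [w^(2/theta) = (m^2 + 1)^(theta^k beta0 / 2)].  Integrating in time bounds
    step [k + 1] by step [k]; the exponents obey [s_(k+1) = 1 + theta s_k], that is
    [r_n = r s_n].

    The Sobolev inequality on the torus follows Gagliardo: [f] is bounded by its
    [W^(1,1)] norm along each coordinate line, and the product of these bounds is
    integrated one coordinate at a time, using Hoelder's inequality for the other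
    [d - 1] factors each time (Loomis-Whitney). *)

Require Import Defs.
From HB Require Import structures.
From mathcomp Require Import all_boot all_order all_algebra.
From mathcomp Require Import all_classical all_reals all_analysis.
From mathcomp Require Import measurable_realfun.
From mathcomp Require Import ring lra.

Set Implicit Arguments.
Unset Strict Implicit.
Unset Printing Implicit Defensive.

Import Order.TTheory GRing.Theory Num.Theory.
Import numFieldNormedType.Exports.
Local Open Scope classical_set_scope.
Local Open Scope ring_scope.

(** The functions put into Sobolev's inequality are bounded below by 1. Hence their real powers are
    differentiable and the integrals have logarithms, and the chain Sobolev, interpolation, Young is
    carried out on logarithms of integrals, where exponents and constants combine linearly. There
    kappa shows its origin: it is the weight given by Hoelder's inequality between the exponents
    2/theta, 2 q and the critical 2 d/(d - 2), and Young's inequality with weight kappa turns B into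
    B^(1/kappa), whence r = 1/kappa. The equation is available only for 0 < t < T, the bound on the
    beta0-norm only at almost every t, and nothing is known outside [0, T] about the smooth
    extensions of u and m. So the energy is not differentiated in time: its increment is written at
    each x as a time integral, Fubini's theorem exchanges the integrals, and the integrands are
    compared almost everywhere. In each estimate the constant is chosen before the Hamiltonian and
    the solution; this order of quantifiers makes C independent of epsilon. *)

Section continuity.
Context {R : realType} {T : topologicalType}.
Implicit Types f g : T -> R.

Lemma continuous_addr f g : continuous f -> continuous g ->
  continuous (fun x => f x + g x).
Proof. by move=> cf cg x; apply: cvgD; [exact: cf|exact: cg]. Qed.

Lemma continuous_subr f g : continuous f -> continuous g ->
  continuous (fun x => f x - g x).
Proof. by move=> cf cg x; apply: cvgB; [exact: cf|exact: cg]. Qed.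

Lemma continuous_oppr f : continuous f -> continuous (fun x => - f x).
Proof. by move=> cf x; apply: cvgN; exact: cf. Qed.

Lemma continuous_mulr f g : continuous f -> continuous g ->
  continuous (fun x => f x * g x).
Proof. by move=> cf cg x; apply: cvgM; [exact: cf|exact: cg]. Qed.

Lemma continuous_maxr f g : continuous f -> continuous g ->
  continuous (fun x => Num.max (f x) (g x)).
Proof. by move=> cf cg x; apply: continuous_max; [exact: cf|exact: cg]. Qed.

Lemma continuous_normr f : continuous f -> continuous (fun x => `|f x|).
Proof. by move=> cf x; apply: cvg_norm; exact: cf. Qed.

Lemma continuous_constr (c : R) : continuous (fun _ : T => c).
Proof. by move=> x; exact: cvg_cst. Qed.

Lemma continuous_bigsum (I : Type) (r : seq I) (P : pred I) (F : I -> T -> R) :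
  (forall i, P i -> continuous (F i)) ->
  continuous (fun x => \sum_(i <- r | P i) F i x).
Proof.
move=> cF; elim: r => [|i r IH].
  by under [X in continuous X]funext do rewrite big_nil; exact: continuous_constr.
under [X in continuous X]funext do rewrite big_cons.
case: (boolP (P i)) => // Pi; apply: continuous_addr => //; exact: cF.
Qed.

Lemma continuous_bigprod (I : Type) (r : seq I) (P : pred I) (F : I -> T -> R) :
  (forall i, P i -> continuous (F i)) ->
  continuous (fun x => \prod_(i <- r | P i) F i x).
Proof.
move=> cF; elim: r => [|i r IH].
  by under [X in continuous X]funext do rewrite big_nil; exact: continuous_constr.
under [X in continuous X]funext do rewrite big_cons.
case: (boolP (P i)) => // Pi; apply: continuous_mulr => //; exact: cF.
Qed.

Lemma continuous_compr (T' : topologicalType) (h : T -> T') (g : T' -> R) :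
  continuous h -> continuous g -> continuous (fun x => g (h x)).
Proof. by move=> ch cg x; exact: (cvg_comp _ _ (ch x) (cg (h x))). Qed.

End continuity.

Lemma continuous_pair1 (T U V : topologicalType) (h : T * U -> V) (x : T) :
  continuous h -> continuous (fun s => h (x, s)).
Proof.
move=> ch s; apply: (@cvg_comp _ _ _ (fun s => (x, s)) h); last exact: ch.
by apply: cvg_pair; [exact: cvg_cst|exact: cvg_id].
Qed.

Lemma continuous_pair2 (T U V : topologicalType) (h : T * U -> V) (s : U) :
  continuous h -> continuous (fun x => h (x, s)).
Proof.
move=> ch x; apply: (@cvg_comp _ _ _ (fun x => (x, s)) h); last exact: ch.
by apply: cvg_pair; [exact: cvg_id|exact: cvg_cst].
Qed.

Lemma continuous_mkpair (T U V : topologicalType) (f : T -> U) (g : T -> V) :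
  continuous f -> continuous g -> continuous (fun x => (f x, g x)).
Proof. by move=> cf cg x; apply: cvg_pair; [exact: cf|exact: cg]. Qed.

Lemma continuous_swap (T U V : topologicalType) (h : T * U -> V) :
  continuous h -> continuous (fun z => h (z.2, z.1)).
Proof.
move=> ch z; apply: (@cvg_comp _ _ _ (fun z => (z.2, z.1)) h); last exact: ch.
by apply: cvg_pair; [exact: cvg_snd|exact: cvg_fst].
Qed.

(** * Integration over the torus *)

Section measurability.
Context {R : realType}.

Lemma cvg_row (T : Type) (F : set_system T) (FF : Filter F) n
    (c : 'I_n -> T -> R) (l : 'rV[R]_n) :
  (forall i, c i x @[x --> F] --> l 0 i) ->
  (\row_i c i x) @[x --> F] --> l.
Proof.
move=> cl; apply/cvg_ballP => e e0.
have H : \forall x \near F, forall i, ball (l 0 i) e (c i x).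
  by apply: filter_forall => i; have /cvg_ballP := cl i; exact.
by apply: filterS H => x H; split => // i j; rewrite mxE ord1.
Qed.

Lemma continuous_row (T : topologicalType) n (c : 'I_n -> T -> R) :
  (forall i, continuous (c i)) -> continuous (fun x => \row_i c i x).
Proof. by move=> cc x; apply: cvg_row => i; rewrite mxE; exact: cc. Qed.

(** Every preimage is a countable union of fibres of [k], so [F] can be arbitrary. *)
Lemma measurable_countable_factor {d} (X : measurableType d) (Z : countType)
    (k : X -> Z) (F : Z -> R) :
  (forall z, measurable (k @^-1` [set z])) -> measurable_fun setT (F \o k).
Proof.
move=> mk _ B mB; rewrite setTI.
rewrite (_ : _ @^-1` B =
    \bigcup_(z : Z) (if F z \in B then k @^-1` [set z] else set0)).
  apply: countable_bigcupT_measurable => // z.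
  by case: ifP => // _; exact: measurable0.
apply/seteqP; split => [x /= Bx|x [z _]].
  by exists (k x) => //; rewrite mem_set.
by case: ifPn => // /set_mem Bz /= ->.
Qed.

(** Rounding the coordinates down to the grid of mesh 1/(N + 1) gives functions that factor through
    countably many integer vectors and converge pointwise by continuity of [f]. This links the
    topology of row vectors to the product sigma-algebra of tuples. *)
Lemma continuous_measurable_coords {d} (X : measurableType d) n
    (c : 'I_n -> X -> R) (f : 'rV[R]_n -> R) :
  (forall i, measurable_fun setT (c i)) -> continuous f ->
  measurable_fun setT (fun x => f (\row_i c i x)).
Proof.
move=> mc cf.
pose k N x : {ffun 'I_n -> int} := [ffun i => Num.floor (c i x * N.+1%:R)].
pose F N (z : {ffun 'I_n -> int}) : R := f (\row_i ((z i)%:~R / N.+1%:R)).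
apply: (@measurable_fun_cvg _ _ _ _ (fun N => F N \o k N)) => [N|x _].
  apply: measurable_countable_factor => z.
  rewrite (_ : _ @^-1` _ = \bigcap_(i in [set: 'I_n])
     (c i @^-1` `[(z i)%:~R / N.+1%:R, (z i + 1)%:~R / N.+1%:R[)).
    apply: fin_bigcap_measurable => // i _.
    by rewrite -[X in measurable X]setTI; exact: mc.
  have iff i y : (y \in `[(z i)%:~R / N.+1%:R, (z i + 1)%:~R / N.+1%:R[) =
      (Num.floor (y * N.+1%:R : R) == z i).
    by rewrite floor_eq in_itv /= ler_pdivrMr// ltr_pdivlMr.
  apply/seteqP; split => y /=.
    move=> kz i _; have := iff i (c i y).
    by rewrite -{3}kz ffunE eqxx.
  by move=> H; apply/ffunP => i; rewrite ffunE; apply/eqP; rewrite -iff; exact: (H i Logic.I).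
suff H : (\row_i ((k N x i)%:~R / N.+1%:R)) @[N --> \oo] --> \row_i c i x.
  exact: (cvg_comp _ _ H (cf _)).
apply: cvg_row => i; rewrite mxE.
apply/cvgrPdist_le => e e0; near=> N.
rewrite ffunE.
have N0 : (0 : R) < N.+1%:R by [].
apply: (@le_trans _ _ N.+1%:R^-1).
  rewrite -{1}(mulfK (lt0r_neq0 N0) (c i x)) -mulrBl normrM.
  rewrite (gtr0_norm (_ : 0 < N.+1%:R^-1)) ?invr_gt0//.
  rewrite ler_piMl ?invr_ge0 ?ltW//.
  have /andP[h1 h2] := floor_itv (c i x * N.+1%:R : R).
  rewrite ger0_norm ?subr_ge0//.
  by rewrite ltrBlDl; move: h2; rewrite intrD.
by apply/ltW; near: N; exact: (near_infty_natSinv_lt (PosNum e0)).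
Unshelve. all: by end_near. Qed.

End measurability.

Section torus_integral.
Context {R : realType}.
Local Open Scope ereal_scope.

Lemma ge0_integral_lebesgue_itv (a b : R) (f : R -> \bar R) :
  measurable_fun setT f -> (forall x, 0 <= f x) ->
  \int[lebesgue_itv a b]_x f x = \int[lebesgue_measure]_(x in `[a, b]) f x.
Proof.
move=> mf f0.
have mI : measurable (~` `[a, b]%classic : set (measurableTypeR R)).
  by apply: measurableC; exact: measurable_itv.
rewrite (@ge0_negligible_integral _ _ _ (lebesgue_itv a b) setT _ f mI)//.
  rewrite setTD setCK; apply: eq_measure_integral => A mA Aab.
  by rewrite /lebesgue_itv/= /mfrestr /mrestr setIidl.
by rewrite /lebesgue_itv/= /mfrestr /mrestr setICl measure0.
Qed.

Lemma integral_lebesgue_itv (a b : R) (f : R -> \bar R) :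
  measurable_fun setT f ->
  \int[lebesgue_itv a b]_x f x = \int[lebesgue_measure]_(x in `[a, b]) f x.
Proof.
move=> mf; rewrite integralE [RHS]integralE.
rewrite !ge0_integral_lebesgue_itv//; first exact: measurable_funeneg.
exact: measurable_funepos.
Qed.

Lemma ge0_integral_tcons n (f : n.+1.-tuple R -> \bar R) :
  measurable_fun [set: n.+1.-tuple (measurableTypeR R)] f -> (forall x, 0 <= f x) ->
  \int[torus_measure n.+1]_x f x =
  \int[lebesgue_itv 0 1]_s \int[torus_measure n]_y f [tuple of s :: y].
Proof.
move=> mf f0; rewrite {1}/torus_measure /=.
rewrite /tcons_measure ge0_integral_pushforward//.
  rewrite preimage_setT fubini_tonelli1//.
  by apply: measurableT_comp => //; exact: measurable_tcons.
by move=> x; exact: f0.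
Qed.

Lemma torus_measureT n : torus_measure n setT = 1 :> \bar R.
Proof.
elim: n => [|n IH]; first by rewrite /torus_measure /= diracT.
rewrite -[LHS]mul1e -integral_cst//.
rewrite ge0_integral_tcons//.
under eq_integral do rewrite integral_cst// mul1e.
rewrite /= IH integral_cst// mul1e /lebesgue_itv /= /mfrestr /mrestr setTI.
by rewrite /= lebesgue_measure_itv/= lte_fin ltr01 sube0.
Qed.

End torus_integral.

Section torus_functional.
Context {R : realType}.
Local Notation mR := (measurableTypeR R).
Local Open Scope ereal_scope.

Lemma continuous_measurable_vec n (f : 'rV[R]_n -> R) : continuous f ->
  measurable_fun [set: n.-tuple mR] (fun x => f (vec x)).
Proof.
move=> cf; apply: (continuous_measurable_coords (c := fun i x => tnth x i)) => // i.
exact: (@measurable_tnth _ mR).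
Qed.

(** Each factor [lebesgue_itv 0 1] lives on [0, 1], so peeling off one coordinate at a time shows
    that values off the cube do not count. A continuous integrand, possibly unbounded on R^n, may
    therefore be altered there. *)
Lemma eq_torus_integral n (F G : n.-tuple R -> \bar R) :
  measurable_fun [set: n.-tuple mR] F -> measurable_fun [set: n.-tuple mR] G ->
  (forall x, 0 <= F x) -> (forall x, 0 <= G x) ->
  (forall x, (forall i, (0 <= tnth x i <= 1)%R) -> F x = G x) ->
  \int[torus_measure n]_x F x = \int[torus_measure n]_x G x.
Proof.
elim: n => [|n IH] in F G * => mF mG F0 G0 FG.
  by apply: eq_integral => x _; apply: FG => -[].
have mc (H : n.+1.-tuple R -> \bar R) : measurable_fun [set: n.+1.-tuple mR] H ->
    measurable_fun setT (fun z : mR * n.-tuple mR => H (tcons z)).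
  by move=> mH; apply: measurableT_comp => //; exact: measurable_tcons.
have mi (H : n.+1.-tuple R -> \bar R) : measurable_fun [set: n.+1.-tuple mR] H ->
    (forall x, 0 <= H x) ->
    measurable_fun setT (fun s : mR => \int[torus_measure n]_y H [tuple of s :: y]).
  move=> mH H0.
  exact: (@measurable_fun_fubini_tonelli_F _ _ mR _ R (torus_measure n)
    (fun z => H (tcons z)) (mc H mH) (fun x => H0 _)).
have ms (H : n.+1.-tuple R -> \bar R) (s : mR) : measurable_fun [set: n.+1.-tuple mR] H ->
    measurable_fun [set: n.-tuple mR] (fun y => H [tuple of s :: y]).
  move=> mH; apply: (@measurableT_comp _ _ _ _ _ _ (fun z => H (tcons z)) _ (fun y => (s, y))).
    exact: mc.
  exact: measurable_pair1.
have pi (H : n.+1.-tuple R -> \bar R) : (forall x, 0 <= H x) ->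
  forall s : mR, 0 <= \int[torus_measure n]_y H [tuple of s :: y].
  by move=> H0 s; exact: integral_ge0.
rewrite (ge0_integral_tcons mF F0) (ge0_integral_tcons mG G0).
rewrite (ge0_integral_lebesgue_itv _ _ (mi F mF F0) (pi F F0)).
rewrite (ge0_integral_lebesgue_itv _ _ (mi G mG G0) (pi G G0)).
apply: eq_integral => s; rewrite inE/= in_itv/= => s01.
apply: IH => //.
- exact: ms.
- exact: ms.
- move=> x x01; apply: FG => i; case: (unliftP ord0 i) => [j ->|->].
    by rewrite tnthS.
  by rewrite tnth0.
Qed.

Lemma continuous_cube_bounded n (f : 'rV[R]_n -> R) : continuous f ->
  exists2 M : R, (0 <= M)%R &
    forall x : n.-tuple R, (forall i, (0 <= tnth x i <= 1)%R) ->
      (`|f (vec x)| <= M)%R.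
Proof.
move=> cf.
pose K := [set v : 'rV[R]_n | forall i, `[0%R, 1%R]%classic (v ord0 i)].
have cK : compact K.
  apply: (@rV_compact R n (fun=> `[0%R, 1%R]%classic)) => i.
  exact: segment_compact.
have [M [_ HM]] : bounded_set (f @` K).
  by apply: compact_bounded; apply: continuous_compact => //; exact: continuous_subspaceT.
exists (Num.max 0 (M + 1))%R; first by rewrite le_max lexx.
move=> x x01; rewrite le_max; apply/orP; right; apply: HM; first by rewrite ltrDl.
by exists (vec x) => // i; rewrite /= in_itv /= mxE.
Qed.

Lemma integrable_torus n (f : 'rV[R]_n -> R) : continuous f ->
  (torus_measure n).-integrable setT (fun x => (f (vec x))%:E).
Proof.
move=> cf; have mf := continuous_measurable_vec cf.
apply/integrableP; split; first exact/measurable_EFinP.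
have [M M0 fM] := continuous_cube_bounded cf.
(* [M] bounds [f] on the cube only; truncation at [M] bounds the integrand everywhere without
   changing its integral. *)
rewrite (@eq_torus_integral _ _ (fun x => (Num.min `|f (vec x)| M)%:E)).
- apply: (@le_lt_trans _ _ (\int[torus_measure n]_x (cst M%:E) x)).
    apply: ge0_le_integral => //=.
    + by move=> x _; rewrite lee_fin le_min normr_ge0 M0.
    + apply/measurable_EFinP; apply: measurable_minr => //.
      exact: measurableT_comp.
    + by move=> x _; rewrite lee_fin ge_min lexx orbT.
  by rewrite integral_cst//= torus_measureT mule1 ltry.
- by apply: measurableT_comp => //; exact/measurable_EFinP.
- apply/measurable_EFinP; apply: measurable_minr => //; exact: measurableT_comp.
- by [].
- by move=> x; rewrite lee_fin le_min normr_ge0 M0.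
- by move=> x x01; rewrite /= min_l// fM.
Qed.

End torus_functional.

(** * Real-valued integrals of continuous functions and their dependence on parameters *)

Section torus_Rintegral.
Context {R : realType}.
Local Notation mR := (measurableTypeR R).

Definition tint n (f : 'rV[R]_n -> R) : R :=
  \int[torus_measure n]_x f (vec x).

Definition pint (a b : R) (f : R -> R) : R :=
  \int[lebesgue_measure]_(s in `[a, b]) f s.

Lemma tintE n (f : 'rV[R]_n -> R) : continuous f ->
  (tint f)%:E = (\int[torus_measure n]_x (f (vec x))%:E)%E.
Proof. by move=> cf; rewrite fineK// integrable_fin_num//; exact: integrable_torus. Qed.

Lemma tintD n (f g : 'rV[R]_n -> R) : continuous f -> continuous g ->
  tint (fun x => f x + g x) = tint f + tint g.
Proof. by move=> cf cg; rewrite /tint RintegralD//; exact: integrable_torus. Qed.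

Lemma tintB n (f g : 'rV[R]_n -> R) : continuous f -> continuous g ->
  tint (fun x => f x - g x) = tint f - tint g.
Proof. by move=> cf cg; rewrite /tint RintegralB//; exact: integrable_torus. Qed.

Lemma tintZ n (c : R) (f : 'rV[R]_n -> R) : continuous f ->
  tint (fun x => c * f x) = c * tint f.
Proof. by move=> cf; rewrite /tint RintegralZl//; exact: integrable_torus. Qed.

Lemma tint_ge0 n (f : 'rV[R]_n -> R) : (forall x, 0 <= f x) -> 0 <= tint f.
Proof. by move=> f0; exact: Rintegral_ge0. Qed.

Lemma tint_cst n (c : R) : @tint n (fun=> c) = c.
Proof. by rewrite /tint Rintegral_cst//= torus_measureT mulr1. Qed.

Lemma tint_sum n (I : Type) (r : seq I) (F : I -> 'rV[R]_n -> R) :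
  (forall i, continuous (F i)) ->
  tint (fun x => \sum_(i <- r) F i x) = \sum_(i <- r) tint (F i).
Proof.
move=> cF; elim: r => [|i r IH].
  by under [X in tint X]funext do rewrite big_nil; rewrite big_nil tint_cst.
under [X in tint X]funext do rewrite big_cons; rewrite big_cons tintD ?IH//.
exact: continuous_bigsum.
Qed.

Lemma le_tint n (f g : 'rV[R]_n -> R) : continuous f -> continuous g ->
  (forall x, f x <= g x) -> tint f <= tint g.
Proof. by move=> cf cg fg; apply: le_Rintegral => //; exact: integrable_torus. Qed.

Lemma le_tint_cube n (f g : 'rV[R]_n -> R) : continuous f -> continuous g ->
  (forall x : 'rV[R]_n, (forall i, 0 <= x 0 i <= 1) -> f x <= g x) ->
  tint f <= tint g.
Proof.
move=> cf cg fg; have cm := continuous_maxr cf cg.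
apply: (@le_trans _ _ (tint (fun x => Num.max (f x) (g x)))).
  by apply: le_tint => // x; rewrite le_max lexx.
have cmg : continuous (fun x => Num.max (f x) (g x) - g x).
  exact: continuous_subr.
rewrite -subr_le0 -tintB// -lee_fin tintE//.
rewrite (@eq_torus_integral _ _ _ (cst 0%E)) ?integral0//.
- by apply/measurable_EFinP; exact: continuous_measurable_vec cmg.
- by move=> x; rewrite lee_fin subr_ge0 le_max lexx orbT.
- move=> x x01; rewrite max_r ?subrr//; apply: fg => i; rewrite mxE; exact: x01.
Qed.

Lemma integrable_pint (a b : R) (f : R -> R) : continuous f ->
  (@lebesgue_measure R).-integrable `[a, b] (EFin \o f).
Proof.
move=> cf; apply: continuous_compact_integrable; first exact: segment_compact.
exact: continuous_subspaceT.
Qed.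

Lemma pintE (a b : R) (f : R -> R) : continuous f ->
  (pint a b f)%:E = (\int[lebesgue_measure]_(s in `[a, b]) (f s)%:E)%E.
Proof.
move=> cf; rewrite fineK// integrable_fin_num//; exact: integrable_pint.
Qed.

Lemma pintD a b (f g : R -> R) : continuous f -> continuous g ->
  pint a b (fun x => f x + g x) = pint a b f + pint a b g.
Proof. by move=> cf cg; rewrite /pint RintegralD//; exact: integrable_pint. Qed.

Lemma pintB a b (f g : R -> R) : continuous f -> continuous g ->
  pint a b (fun x => f x - g x) = pint a b f - pint a b g.
Proof. by move=> cf cg; rewrite /pint RintegralB//; exact: integrable_pint. Qed.

Lemma pintZ a b (c : R) (f : R -> R) : continuous f ->
  pint a b (fun x => c * f x) = c * pint a b f.
Proof. by move=> cf; rewrite /pint RintegralZl//; exact: integrable_pint. Qed.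

Lemma pint_cst a b (c : R) : a <= b -> pint a b (fun=> c) = c * (b - a).
Proof.
move=> ab; rewrite /pint Rintegral_cst//= lebesgue_measure_itv /= lte_fin.
by case: ltrgtP ab => // [-> _]; rewrite subrr.
Qed.

Lemma le_pint a b (f g : R -> R) : continuous f -> continuous g ->
  (forall x, a <= x <= b -> f x <= g x) -> pint a b f <= pint a b g.
Proof.
move=> cf cg fg; apply: le_Rintegral; [by []|exact: integrable_pint|exact: integrable_pint|].
by move=> x /=; rewrite in_itv; exact: fg.
Qed.

(** Tube lemma: compactness of [K] turns joint continuity at each point (p, x) into one
    neighbourhood of [p] valid for all [x] in [K]. Continuity of parametric integrals follows. *)
Lemma near_uniform_compact (P X : topologicalType) (K : set X) (h : P * X -> R)
    (p : P) (e : R) : compact K -> continuous h -> 0 < e ->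
  \forall p' \near p, forall x, K x -> `|h (p', x) - h (p, x)| <= e.
Proof.
move=> cK ch e0; have /compact_near_coveringP nK := cK.
apply: (nK _ _ (fun p' x => `|h (p', x) - h (p, x)| <= e)) => x Kx.
have e20 : 0 < e / 2 by rewrite divr_gt0.
have H : \forall z \near (p, x), `|h (p, x) - h z| < e / 2.
  by have /cvgrPdist_lt/(_ _ e20) := ch (p, x).
have H1 : \forall x' \near x & p' \near p, `|h (p, x) - h (p', x')| < e / 2.
  by case: H => -[U V] /= [nU nV] UV; exists (V, U) => // -[x' p'] /= [? ?]; exact: (UV (p', x')).
have H2 : \forall x' \near x & p' \near p, `|h (p, x) - h (p, x')| < e / 2.
  have /cvgrPdist_lt/(_ _ e20) H2 := @continuous_pair1 _ _ _ h p ch x.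
  by exists ([set x' | `|h (p, x) - h (p, x')| < e / 2], setT);
    [split => //; exact: filterT|move=> -[x' p'] /= []].
apply: filterS2 H1 H2 => -[x' p'] /= h1 h2.
move: h1 h2; rewrite !ltr_norml ler_norml => /andP[? ?] /andP[? ?].
by apply/andP; split; lra.
Qed.

Lemma continuous_pint (P : topologicalType) a b (h : P * R -> R) : a <= b ->
  continuous h -> continuous (fun p => pint a b (fun s => h (p, s))).
Proof.
move=> ab ch p; apply/cvgrPdist_le => e e0.
(* The added 1 keeps the denominator positive when [a = b]. *)
have d0 : 0 < e / (b - a + 1) by rewrite divr_gt0// ltr_wpDl// subr_ge0.
have H := near_uniform_compact p (@segment_compact R a b) ch d0.
apply: filterS H => p' H.
have cp q : continuous (fun s => h (q, s)) by exact: continuous_pair1.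
have bound : e / (b - a + 1) * (b - a) <= e.
  rewrite mulrAC ler_pdivrMr; last by rewrite ltr_wpDl// subr_ge0.
  by rewrite ler_wpM2l ?ltW// ltrDl.
rewrite distrC ler_norml -!pintB//; apply/andP; split.
  apply: (@le_trans _ _ (pint a b (fun=> - (e / (b - a + 1))))).
    by rewrite pint_cst// mulNr lerN2.
  apply: le_pint; [exact: continuous_constr|apply: continuous_subr; exact: cp|].
  by move=> x xab; have := H x; rewrite /= in_itv/= ler_norml => /(_ xab)/andP[].
apply: (@le_trans _ _ (pint a b (fun=> e / (b - a + 1)))); last by rewrite pint_cst.
apply: le_pint; [apply: continuous_subr; exact: cp|exact: continuous_constr|].
by move=> x xab; have := H x; rewrite /= in_itv/= ler_norml => /(_ xab)/andP[].
Qed.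

Lemma continuous_tint (P : topologicalType) n (h : P * 'rV[R]_n -> R) :
  continuous h -> continuous (fun p => tint (fun s => h (p, s))).
Proof.
move=> ch p; apply/cvgrPdist_le => e e0.
have cK : compact [set v : 'rV[R]_n | forall i, `[0, 1]%classic (v ord0 i)].
  apply: (@rV_compact R n (fun=> `[0%R, 1%R]%classic)) => i.
  exact: segment_compact.
have H := near_uniform_compact p cK ch e0.
apply: filterS H => p' H.
have cp q : continuous (fun s => h (q, s)) by exact: continuous_pair1.
rewrite distrC ler_norml -!tintB//; apply/andP; split.
  rewrite -[leLHS](tint_cst n).
  apply: le_tint_cube; [exact: continuous_constr|apply: continuous_subr; exact: cp|].
  move=> x x01; have := H x; rewrite ler_norml => H'.
  by have /andP[] := H' (fun i => ltac:(rewrite /= in_itv; exact: x01)).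
rewrite -[leRHS](tint_cst n).
apply: le_tint_cube; [apply: continuous_subr; exact: cp|exact: continuous_constr|].
move=> x x01; have := H x; rewrite ler_norml => H'.
by have /andP[] := H' (fun i => ltac:(rewrite /= in_itv; exact: x01)).
Qed.

End torus_Rintegral.

(** * Exchange of space and time integrals *)

Section fubini.
Context {R : realType}.
Local Notation mR := (measurableTypeR R).

Lemma measurable_vec_pair n (h : 'rV[R]_n * R -> R) : continuous h ->
  measurable_fun [set: n.-tuple mR * mR] (fun z => h (vec z.1, z.2)).
Proof.
move=> ch.
(* Time becomes coordinate 0 of a vector of length n + 1, so that [continuous_measurable_coords]
   applies. *)
pose c (i : 'I_n.+1) (z : n.-tuple mR * mR) : R :=
  if unlift ord0 i is Some j then tnth z.1 j else z.2.
pose h' (v : 'rV[R]_n.+1) := h (\row_j v ord0 (lift ord0 j), v ord0 ord0).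
have -> : (fun z : n.-tuple mR * mR => h (vec z.1, z.2)) =
    (fun z => h' (\row_i c i z)).
  apply/funext => z; rewrite /h' mxE /c unlift_none; congr (h (_, _)).
  by apply/rowP => j; rewrite !mxE liftK.
apply: continuous_measurable_coords => [i|].
  rewrite /c; case: (unlift ord0 i) => [j|]; last exact: measurable_snd.
  apply: (@measurableT_comp _ _ _ _ _ _ (fun t : n.-tuple mR => tnth t j)).
    exact: measurable_tnth.
  exact: measurable_fst.
apply: continuous_compr ch; apply: continuous_mkpair.
  by apply: continuous_row => j; exact: coord_continuous.
exact: coord_continuous.
Qed.

Lemma continuous_negpart (T : topologicalType) (h : T -> R) : continuous h ->
  continuous (fun x => Num.max (- h x) 0).
Proof.
move=> ch; apply: continuous_maxr; last exact: continuous_constr.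
exact: continuous_oppr.
Qed.

Lemma continuous_pospart (T : topologicalType) (h : T -> R) : continuous h ->
  continuous (fun x => Num.max (h x) 0).
Proof. by move=> ch; apply: continuous_maxr => //; exact: continuous_constr. Qed.

Lemma posnegE (x : R) : x = Num.max x 0 - Num.max (- x) 0.
Proof.
have [x0|x0] := leP 0 x.
  by rewrite max_r ?subr0// lerNl oppr0.
by rewrite max_l ?sub0r ?opprK// ltW// ltrNr oppr0.
Qed.

Let ge0_tint_pint n a b (h : 'rV[R]_n * R -> R) : continuous h ->
  (forall z, 0 <= h z) ->
  tint (fun x => pint a b (fun s => h (x, s))) =
  pint a b (fun s => tint (fun x => h (x, s))).
Proof.
move=> ch h0.
have mEh : measurable_fun [set: n.-tuple mR * mR] (fun z => (h (vec z.1, z.2))%:E).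
  by apply/measurable_EFinP; exact: measurable_vec_pair.
have Eh0 (z : n.-tuple mR * mR) : (0 <= (h (vec z.1, z.2))%:E)%E by rewrite lee_fin.
rewrite /tint /pint /Rintegral; congr fine.
transitivity (\int[torus_measure n]_x \int[lebesgue_itv a b]_s (h (vec x, s))%:E)%E.
  apply: eq_integral => x _; have cx := continuous_pair1 (x := vec x) ch.
  rewrite -/(Rintegral _ _ _) -/(pint a b _) pintE// integral_lebesgue_itv//.
  by apply/measurable_EFinP; exact: continuous_measurable_fun.
have := fubini_tonelli (m1 := torus_measure n) (m2 := lebesgue_itv a b) _ mEh Eh0.
rewrite /fubini_F /fubini_G /= => ->.
rewrite ge0_integral_lebesgue_itv//.
- apply: eq_integral => s _; have cs := continuous_pair2 (s := s) ch.
  exact: (esym (tintE cs)).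
- exact: (@measurable_fun_fubini_tonelli_G _ _ _ mR R (torus_measure n) _ mEh Eh0).
- by move=> s; apply: integral_ge0 => x _; rewrite lee_fin.
Qed.

(** The positive and negative parts are again continuous, so Tonelli's theorem for each of them
    gives the signed case by subtraction. *)
Lemma tint_pint n a b (h : 'rV[R]_n * R -> R) : a <= b -> continuous h ->
  tint (fun x => pint a b (fun s => h (x, s))) =
  pint a b (fun s => tint (fun x => h (x, s))).
Proof.
move=> ab ch.
have cp := continuous_pospart ch; have cn := continuous_negpart ch.
under [X in tint X]funext => x.
  under [X in pint _ _ X]funext do rewrite (posnegE (h _)).
  rewrite pintB; [|exact: (continuous_pair1 cp)|exact: (continuous_pair1 cn)].
  over.
rewrite tintB; [|exact: (continuous_pint ab cp)|exact: (continuous_pint ab cn)].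
have m0 (x : R) : 0 <= Num.max x 0 by rewrite le_max lexx orbT.
rewrite (ge0_tint_pint _ _ cp (fun z => m0 _)) (ge0_tint_pint _ _ cn (fun z => m0 _)).
under [X in _ = pint _ _ X]funext => s.
  under [X in tint X]funext do rewrite (posnegE (h _)).
  rewrite tintB; [|exact: (continuous_pair2 cp)|exact: (continuous_pair2 cn)].
  over.
by rewrite pintB//; [exact: (continuous_tint (continuous_swap cp))|
  exact: (continuous_tint (continuous_swap cn))].
Qed.

End fubini.

(** * Slices of the torus and averages along one coordinate *)

Section averages.
Context {R : realType}.
Local Notation mR := (measurableTypeR R).

Definition upd n (x : 'rV[R]_n) (k : 'I_n) (s : R) : 'rV[R]_n :=
  \row_j (if j == k then s else x 0 j).

(** The average remains a function of all [n] coordinates, constant in the [k]-th, so averages in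
    several directions compose without a change of dimension. *)
Definition avg n (k : 'I_n) (f : 'rV[R]_n -> R) (x : 'rV[R]_n) : R :=
  pint 0 1 (fun s => f (upd x k s)).

Definition cons_row n (s : R) (y : 'rV[R]_n) : 'rV[R]_n.+1 :=
  \row_j (if unlift ord0 j is Some i then y 0 i else s).

Lemma continuous_upd n (k : 'I_n) :
  continuous (fun z : 'rV[R]_n * R => upd z.1 k z.2).
Proof.
apply: continuous_row => j; case: (j == k); first by move=> z; exact: cvg_snd.
apply: (@continuous_compr _ _ _ fst (fun x : 'rV[R]_n => x 0 j)).
  by move=> z; exact: cvg_fst.
exact: coord_continuous.
Qed.

Lemma continuous_cons_row n :
  continuous (fun z : 'rV[R]_n * R => cons_row z.2 z.1).
Proof.
apply: continuous_row => j; case: (unlift ord0 j) => [i|].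
  apply: (@continuous_compr _ _ _ fst (fun x : 'rV[R]_n => x 0 i)).
    by move=> z; exact: cvg_fst.
  exact: coord_continuous.
by move=> z; exact: cvg_snd.
Qed.

Lemma vec_cons n (s : R) (y : n.-tuple R) :
  vec [tuple of s :: y] = cons_row s (vec y).
Proof.
apply/rowP => j; rewrite !mxE; case: (unliftP ord0 j) => [i ->|->].
  by rewrite tnthS mxE.
by rewrite tnth0.
Qed.

Lemma upd_cons0 n (s t : R) (y : 'rV[R]_n) :
  upd (cons_row s y) ord0 t = cons_row t y.
Proof.
apply/rowP => j; rewrite !mxE; case: (unliftP ord0 j) => [i ->|->].
  by rewrite eq_sym (negbTE (neq_lift _ _)).
by rewrite eqxx.
Qed.

Lemma upd_consS n (s t : R) (y : 'rV[R]_n) (i : 'I_n) :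
  upd (cons_row s y) (lift ord0 i) t = cons_row s (upd y i t).
Proof.
apply/rowP => j; rewrite !mxE; case: (unliftP ord0 j) => [l ->|->].
  by rewrite (inj_eq lift_inj) mxE.
by rewrite (negbTE (neq_lift _ _)).
Qed.

Lemma continuous_avg n (k : 'I_n) (f : 'rV[R]_n -> R) :
  continuous f -> continuous (avg k f).
Proof.
move=> cf; apply: (continuous_pint ler01 (h := fun z => f (upd z.1 k z.2))).
exact: continuous_compr (@continuous_upd n k) cf.
Qed.

Let ge0_tint_cons n (f : 'rV[R]_n.+1 -> R) : continuous f -> (forall x, 0 <= f x) ->
  tint f = pint 0 1 (fun s => tint (fun y => f (cons_row s y))).
Proof.
move=> cf f0.
have ch : continuous (fun z : 'rV[R]_n * R => f (cons_row z.2 z.1)).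
  exact: continuous_compr (@continuous_cons_row n) cf.
have mf : measurable_fun [set: n.+1.-tuple mR] (fun x => (f (vec x))%:E).
  by apply/measurable_EFinP; exact: continuous_measurable_vec.
have Ef0 (x : n.+1.-tuple R) : (0 <= (f (vec x))%:E)%E by rewrite lee_fin.
rewrite /pint /tint /Rintegral; congr fine.
rewrite (ge0_integral_tcons mf Ef0).
have ct : continuous (fun s => tint (fun y => f (cons_row s y))).
  exact: continuous_tint (continuous_swap ch).
transitivity (\int[lebesgue_itv 0 1]_s
    (tint (fun y => f (cons_row s y)))%:E)%E.
  apply: eq_integral => s _; rewrite (tintE (continuous_pair2 (s := s) ch)).
  by apply: eq_integral => y _; rewrite vec_cons.
rewrite integral_lebesgue_itv//.
by apply/measurable_EFinP; exact: continuous_measurable_fun.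
Qed.

Lemma tint_cons n (f : 'rV[R]_n.+1 -> R) : continuous f ->
  tint f = pint 0 1 (fun s => tint (fun y => f (cons_row s y))).
Proof.
move=> cf; have cp := continuous_pospart cf; have cn := continuous_negpart cf.
have ch (g : 'rV[R]_n.+1 -> R) : continuous g ->
    continuous (fun z : 'rV[R]_n * R => g (cons_row z.2 z.1)).
  by move=> cg; exact: continuous_compr (@continuous_cons_row n) cg.
have m0 (x : R) : 0 <= Num.max x 0 by rewrite le_max lexx orbT.
under [X in tint X]funext do rewrite (posnegE (f _)).
rewrite tintB// (ge0_tint_cons cp (fun=> m0 _)) (ge0_tint_cons cn (fun=> m0 _)).
rewrite -pintB; [|exact: continuous_tint (continuous_swap (ch _ cp))|
  exact: continuous_tint (continuous_swap (ch _ cn))].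
apply: (congr1 (pint 0 1)); apply/funext => s.
rewrite -tintB; [|exact: (continuous_pair2 (s := s) (ch _ cp))|
  exact: (continuous_pair2 (s := s) (ch _ cn))].
by apply: congr1; apply/funext => y; rewrite -posnegE.
Qed.

Lemma tint_avg n (k : 'I_n) (f : 'rV[R]_n -> R) : continuous f ->
  tint (avg k f) = tint f.
Proof.
elim: n => [|n IH] in k f *; first by case: k.
move=> cf; rewrite tint_cons; last exact: continuous_avg.
have ch : continuous (fun z : 'rV[R]_n * R => f (cons_row z.2 z.1)).
  exact: continuous_compr (@continuous_cons_row n) cf.
(* A later direction is handled by the induction hypothesis on each slice. In direction 0 the
   averaged slice integral no longer depends on [s], and [tint_pint] undoes the average. *)
case: (unliftP ord0 k) => [i ->|->].
  rewrite [RHS](tint_cons cf); apply: (congr1 (pint 0 1)); apply/funext => s.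
  rewrite -[RHS](IH i); last exact: (continuous_pair2 (s := s) ch).
  apply: congr1; apply/funext => y; apply: (congr1 (pint 0 1)); apply/funext => t.
  by rewrite upd_consS.
under [X in pint _ _ X]funext => s.
  rewrite /avg; under [X in tint X]funext do
    under [X in pint _ _ X]funext do rewrite upd_cons0.
  over.
rewrite pint_cst// subr0 mulr1 (tint_pint ler01 ch).
exact: (esym (tint_cons cf)).
Qed.

End averages.

(** * Sobolev and Gagliardo-Nirenberg inequalities *)

Section hoelder.
Context {R : realType}.

Lemma prodr_powR_exp (I : finType) (P : pred I) (a y : I -> R) :
  (forall i, P i -> 0 < y i) ->
  \prod_(i | P i) y i `^ a i = expR (\sum_(i | P i) a i * ln (y i)).
Proof.
move=> y0; rewrite expR_sum; apply: eq_bigr => i Pi.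
by rewrite /powR gt_eqF// y0.
Qed.

(** Normalize by the weighted mean S and sum the inequalities ln (y_i / S) <= y_i / S - 1 with
    weights a_i: the right-hand side adds up to 0. *)
Lemma weighted_AMGM (I : finType) (P : pred I) (a y : I -> R) :
  (forall i, P i -> 0 <= a i) -> \sum_(i | P i) a i = 1 ->
  (forall i, P i -> 0 < y i) ->
  \prod_(i | P i) y i `^ a i <= \sum_(i | P i) a i * y i.
Proof.
move=> a0 a1 y0; set S := \sum_(i | P i) a i * y i.
have S0 : 0 < S.
  rewrite lt_neqAle sumr_ge0 ?andbT => [|i Pi]; last first.
    by rewrite mulr_ge0 ?a0// ltW// y0.
  apply/eqP => /esym S0.
  have H := psumr_eq0P (fun i Pi => mulr_ge0 (a0 i Pi) (ltW (y0 i Pi))) S0.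
  move/eqP : a1; rewrite big1 => [|i Pi]; first by rewrite eq_sym oner_eq0.
  by have /eqP := H i Pi; rewrite mulf_eq0 (gt_eqF (y0 i Pi)) orbF => /eqP.
rewrite prodr_powR_exp// -ler_ln ?posrE ?expR_gt0// expRK.
rewrite -[leRHS]mul1r -a1 mulr_suml -subr_le0 -sumrB.
rewrite (@le_trans _ _ (\sum_(i | P i) a i * (y i / S - 1)))//; last first.
  under eq_bigr do rewrite mulrBr mulr1 mulrA.
  by rewrite sumrB -mulr_suml -/S a1 divff ?subrr// gt_eqF.
apply: ler_sum => i Pi; rewrite -mulrBr ler_wpM2l ?a0//.
rewrite -ln_div ?posrE ?y0//.
have := @le_ln1Dx R (y i / S - 1); rewrite (addrC 1) subrK; apply.
by rewrite ltrBrDr addNr divr_gt0// y0.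
Qed.

(** Abstracts what Hoelder's inequality needs, so that one proof serves both the integral [tint] and
    the partial average [avg k _ x] at a fixed point. *)
Record positive_functional (T : topologicalType) (L : (T -> R) -> R) : Prop := {
  pfD : forall f g : T -> R, continuous f -> continuous g ->
    L (fun x => f x + g x) = L f + L g;
  pfZ : forall (c : R) (f : T -> R), continuous f -> L (fun x => c * f x) = c * L f;
  pf_le : forall f g : T -> R, continuous f -> continuous g ->
    (forall x, f x <= g x) -> L f <= L g;
  pf1 : L (fun=> 1) = 1 }.

Lemma pf_ge1 (T : topologicalType) (L : (T -> R) -> R) (f : T -> R) :
  positive_functional L -> continuous f -> (forall x, 1 <= f x) -> 1 <= L f.
Proof.
move=> pL cf f1; rewrite -(pf1 pL); apply: (pf_le pL) => //.
exact: continuous_constr.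
Qed.

Lemma pf_sum (T : topologicalType) (L : (T -> R) -> R) (I : Type) (r : seq I)
    (P : pred I) (F : I -> T -> R) :
  positive_functional L -> (forall i, continuous (F i)) ->
  L (fun x => \sum_(i <- r | P i) F i x) = \sum_(i <- r | P i) L (F i).
Proof.
move=> pL cF; elim: r => [|i r IH].
  under [X in L X]funext do rewrite big_nil; rewrite big_nil.
  have := pfZ pL 0 (@continuous_constr R T 1); rewrite !mul0r; exact.

under [X in L X]funext do rewrite big_cons; rewrite big_cons.
case: (boolP (P i)) => // Pi; rewrite (pfD pL) ?IH//.
exact: continuous_bigsum.
Qed.

Lemma continuous_powR (T : topologicalType) (f : T -> R) (a : R) :
  continuous f -> (forall x, 0 < f x) -> continuous (fun x => f x `^ a).
Proof.
move=> cf f0 x.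
apply: (@cvg_comp _ _ _ f (fun y => y `^ a) (nbhs x) (nbhs (f x))); first exact: cf.
suff H : {for f x, continuous (fun y : R => y `^ a)} by exact: H.
apply: differentiable_continuous; apply/derivable1_diffP.
by apply: derivable_powR; rewrite in_itv /= f0.
Qed.

(** Pointwise [weighted_AMGM] for the normalized functions f_i / L f_i, followed by [L]. The bound 1
    <= f_i ensures L f_i > 0 and the continuity of the powers. *)
Lemma generalized_hoelder (T : topologicalType) (L : (T -> R) -> R) (I : finType)
    (P : pred I) (a : I -> R) (f : I -> T -> R) :
  positive_functional L ->
  (forall i, P i -> 0 <= a i) -> \sum_(i | P i) a i = 1 ->
  (forall i, continuous (f i)) -> (forall i x, 1 <= f i x) ->
  L (fun x => \prod_(i | P i) f i x `^ a i) <= \prod_(i | P i) L (f i) `^ a i.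
Proof.
move=> pL a0 a1 cf f1.
have f0 i x : 0 < f i x by exact: lt_le_trans ltr01 (f1 i x).
have L0 i : 0 < L (f i) by apply: lt_le_trans ltr01 _; exact: pf_ge1.
set A := \prod_(i | P i) L (f i) `^ a i.
have A0 : 0 <= A by apply: prodr_ge0 => i _; exact: powR_ge0.
have cS : continuous (fun x => \sum_(i | P i) a i / L (f i) * f i x).
  by apply: continuous_bigsum => i _; apply: continuous_mulr => //; exact: continuous_constr.
apply: (@le_trans _ _ (L (fun x => A * \sum_(i | P i) a i / L (f i) * f i x))).
  apply: (pf_le pL).
  - by apply: continuous_bigprod => i _; exact: continuous_powR.
  - by apply: continuous_mulr => //; exact: continuous_constr.
  move=> x.
  have -> : \prod_(i | P i) f i x `^ a i =
      A * \prod_(i | P i) (f i x / L (f i)) `^ a i.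
    rewrite -big_split/=; apply: eq_bigr => i Pi.
    by rewrite -powRM ?divr_ge0 ?ltW// mulrC divfK// gt_eqF.
  rewrite ler_wpM2l//; under [leRHS]eq_bigr do rewrite mulrAC -mulrA.
  by apply: weighted_AMGM => // i Pi; rewrite divr_gt0.
rewrite (pfZ pL)// pf_sum//; last first.
  by move=> i; apply: continuous_mulr => //; exact: continuous_constr.
under eq_bigr do rewrite (pfZ pL)// divfK ?gt_eqF//.
by rewrite a1 mulr1.
Qed.

Lemma positive_functional_tint n : positive_functional (@tint R n).
Proof.
split; [exact: tintD|exact: tintZ|exact: le_tint|exact: tint_cst].
Qed.

End hoelder.

(** * The Loomis-Whitney inequality *)

Section loomis_whitney.
Context {R : realType} {n : nat}.
Implicit Types (f : 'rV[R]_n -> R) (k : 'I_n).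

Definition indep k f := forall x s, f (upd x k s) = f x.

Lemma upd_upd (x : 'rV[R]_n) k s t : upd (upd x k s) k t = upd x k t.
Proof. by apply/rowP => j; rewrite !mxE; case: eqP. Qed.

Lemma updC (x : 'rV[R]_n) k l s t : k != l ->
  upd (upd x k s) l t = upd (upd x l t) k s.
Proof.
move=> kl; apply/rowP => j; rewrite !mxE.
by have [->|//] := eqVneq j l; rewrite eq_sym (negbTE kl).
Qed.

Lemma upd_id (x : 'rV[R]_n) k : upd x k (x 0 k) = x.
Proof. by apply/rowP => j; rewrite !mxE; case: eqP => [->|]. Qed.

Lemma indep_avg_id k f : indep k (avg k f).
Proof.
by move=> x s; apply: (congr1 (pint 0 1)); apply/funext => t; rewrite upd_upd.
Qed.

Lemma indep_avg k l f : indep l f -> indep l (avg k f).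
Proof.
have [->|kl] := eqVneq k l; first by move=> _; exact: indep_avg_id.
move=> fl x s; apply: (congr1 (pint 0 1)); apply/funext => t.
by rewrite updC 1?eq_sym// fl.
Qed.

Lemma avg_indep k f : indep k f -> avg k f = f.
Proof.
move=> fk; apply/funext => x; rewrite /avg.
under [X in pint _ _ X]funext do rewrite fk.
by rewrite pint_cst// subr0 mulr1.
Qed.

Lemma indep_cst f : (forall k, indep k f) -> forall x, f x = f 0.
Proof.
move=> fi x.
(* The fold overwrites the coordinates of 0 by those of [x] one at a time, and [f] does not
   notice. *)
suff H : f (foldr (fun k y => upd y k (x 0 k)) 0 (enum 'I_n)) = f 0.
  rewrite -H; congr f; apply/rowP => j.
  have : j \in enum 'I_n by rewrite mem_enum.
  elim: (enum _) => //= k s IH; rewrite inE mxE.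
  by have [->|jk] := eqVneq j k.
by elim: (enum _) => //= k s IH; rewrite fi.
Qed.

Lemma positive_functional_avg k (x : 'rV[R]_n) :
  positive_functional (fun f : 'rV[R]_n -> R => avg k f x).
Proof.
have cu : continuous (fun s => upd x k s).
  exact: (continuous_pair1 (x := x) (@continuous_upd R n k)).
have cfu f : continuous f -> continuous (fun s => f (upd x k s)).
  by move=> cf; exact: continuous_compr cu cf.
split => [f g cf cg|c f cf|f g cf cg fg|].
- by apply: pintD; exact: cfu.
- by apply: pintZ; exact: cfu.
- by apply: le_pint; [exact: cfu|exact: cfu|].
- by rewrite /avg pint_cst// subr0 mulr1.
Qed.

(* Averaging in the direction [k] leaves the integral unchanged; the factor
   [g k] is constant in that direction, so Hoelder's inequality with [n - 1]
   equal exponents moves the average inside the product. *)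
Lemma loomis_whitney (g : 'I_n -> 'rV[R]_n -> R) (a : R) :
  0 <= a -> a * (n%:R - 1) = 1 ->
  (forall i, continuous (g i)) -> (forall i x, 1 <= g i x) ->
  (forall i, indep i (g i)) ->
  tint (fun x => \prod_i g i x `^ a) <= \prod_i tint (g i) `^ a.
Proof.
move=> a0 an cg g1 gi.
pose avgs (ks : seq 'I_n) f := foldr (@avg R n) f ks.
have cavgs ks i : continuous (avgs ks (g i)).
  by elim: ks => [|k ks IH]; [exact: cg|exact: continuous_avg].
have avgs1 ks i x : 1 <= avgs ks (g i) x.
  elim: ks x => [|k ks IH] x; first exact: g1.
  by apply: (pf_ge1 (positive_functional_avg k x)) => //; exact: cavgs.
have iavgs ks i k : (k == i) || (k \in ks) -> indep k (avgs ks (g i)).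
  elim: ks => [|l ks IH]; first by rewrite orbF => /eqP ->; exact: gi.
  rewrite inE orbCA => /orP[/eqP ->|/IH]; first exact: indep_avg_id.
  exact: indep_avg.
have tavgs ks i : tint (avgs ks (g i)) = tint (g i).
  by elim: ks => [//|k ks IH]; rewrite -[RHS]IH; exact: tint_avg (cavgs ks i).
have cprod ks : continuous (fun x => \prod_i avgs ks (g i) x `^ a).
  apply: continuous_bigprod => i _; apply: continuous_powR => // x.
  exact: lt_le_trans ltr01 (avgs1 _ _ _).
have step ks : tint (fun x => \prod_i g i x `^ a) <=
    tint (fun x => \prod_i avgs ks (g i) x `^ a).
  elim: ks => [//|k ks IH]; apply: (le_trans IH).
  rewrite -[leLHS](tint_avg k (cprod ks)).
  apply: le_tint; [exact: continuous_avg (cprod ks)|exact: (cprod (k :: ks))|].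
  move=> x; rewrite [leRHS](bigD1 k)//=.
  rewrite (avg_indep (f := avgs ks (g k))); last by apply: iavgs; rewrite eqxx.
  have -> : avg k (fun x => \prod_i avgs ks (g i) x `^ a) x =
      avgs ks (g k) x `^ a * avg k (fun x => \prod_(i | i != k) avgs ks (g i) x `^ a) x.
    rewrite -(pfZ (positive_functional_avg k x)); last first.
      apply: continuous_bigprod => i _; apply: continuous_powR => // y.
      exact: lt_le_trans ltr01 (avgs1 _ _ _).
    apply: (congr1 (pint 0 1)); apply/funext => s; rewrite (bigD1 k)//=.
    by rewrite iavgs// eqxx.
  rewrite ler_wpM2l ?powR_ge0//.
  apply: (generalized_hoelder (positive_functional_avg k x) (a := fun=> a)) => //.
  have nE : n%:R - 1 = n.-1%:R :> R by rewrite -[in LHS](ltn_predK (ltn_ord k)) -natr1 addrK.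
  by rewrite sumr_const cardC1 card_ord -mulr_natr -nE.
apply: (le_trans (step (enum 'I_n))).
(* Once averaged in every direction a factor is constant, and averaging has preserved its
   integral. *)
have E i x : avgs (enum 'I_n) (g i) x = tint (g i).
  have H y : avgs (enum 'I_n) (g i) y = avgs (enum 'I_n) (g i) 0.
    by apply: indep_cst => k; apply: iavgs; rewrite mem_enum orbT.
  rewrite H -(tavgs (enum 'I_n)) -[LHS](tint_cst n).
  by congr tint; apply/funext => y; rewrite H.
under [X in tint X]funext do under eq_bigr do rewrite E.
by rewrite tint_cst.
Qed.

End loomis_whitney.

(** * Bounds along coordinate lines and the embedding of W^(1,1) *)

Section sobolev.
Context {R : realType}.

Lemma pint_FTC (a b : R) (h h' : R -> R) : a <= b -> continuous h' ->
  (forall s : R, is_derive s 1 h (h' s)) -> pint a b h' = h b - h a.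
Proof.
rewrite le_eqVlt => /predU1P[<- _ _|ab ch' hh'].
  by rewrite subrr /pint set_itv1 Rintegral_set1.
have ch : continuous h.
  move=> s; apply: differentiable_continuous; apply/derivable1_diffP.
  by have [] := hh' s.
have := @continuous_FTC2 R h' h a b ab (continuous_subspaceT ch').
rewrite -pintE// -EFinB => H; apply: EFin_inj; apply: H.
  split.
  - by move=> x _; have [] := hh' x.
  - by apply: cvg_at_right_filter; exact: ch.
  - by apply: cvg_at_left_filter; exact: ch.
by move=> x _; rewrite derive1E; have [_ ->] := hh' x.
Qed.

Lemma le_pint_subset (a b s t : R) (f : R -> R) : continuous f -> (forall x, 0 <= f x) ->
  a <= s -> t <= b -> pint s t f <= pint a b f.
Proof.
move=> cf f0 sa tb; rewrite -lee_fin !pintE//.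
apply: ge0_subset_integral => //.
- by apply/measurable_EFinP; apply: measurable_funTS; exact: continuous_measurable_fun.
- by move=> x _; rewrite lee_fin.
- by move=> x /=; rewrite !in_itv/= => /andP[sx xt]; rewrite (le_trans sa sx) (le_trans xt tb).
Qed.

Lemma periodic_int (h : R -> R) : (forall s, h (s + 1) = h s) ->
  forall (z : int) s, h (s + z%:~R) = h s.
Proof.
move=> h1; have hn (m : nat) s : h (s + m%:R) = h s.
  by elim: m s => [|m IH] s; [rewrite addr0|rewrite -natr1 addrA h1 IH].
case=> m s; first exact: hn.
by rewrite -(hn m.+1) NegzE mulrNz subrK.
Qed.

(** Periodicity brings [t] into [0, 1]. There h t minus the integral of |h'| is at most h s for
    every [s] in [0, 1], and averaging over [s] gives the claim. *)
Lemma le_pint_periodic (h h' : R -> R) : continuous h' ->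
  (forall s : R, is_derive s 1 h (h' s)) -> (forall s, h (s + 1) = h s) ->
  forall t, h t <= pint 0 1 (fun s => h s + `|h' s|).
Proof.
move=> ch' hh' h1 t.
have ch : continuous h.
  move=> s; apply: differentiable_continuous; apply/derivable1_diffP.
  by have [] := hh' s.
have cn := continuous_normr ch'.
wlog t01 : t / 0 <= t <= 1.
  move=> W; rewrite -(periodic_int h1 (- Num.floor t)).
  apply: W; rewrite mulrNz subr_ge0 floor_le_tmp/=.
  have /andP[h2 h3] := floor_itv t.
  by rewrite lerBlDr addrC ltW//; move: h3; rewrite intrD.
have /andP[t0 t1] := t01.
have key s : 0 <= s <= 1 -> h t - pint 0 1 (fun s => `|h' s|) <= h s.
  move=> /andP[s0 s1]; have [st|ts] := leP s t.
    rewrite lerBlDr addrC -lerBlDr -(pint_FTC st ch' hh').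
    apply: (@le_trans _ _ (pint s t (fun s => `|h' s|))).
      by apply: le_pint => // x _; exact: ler_norm.
    exact: le_pint_subset.
  rewrite lerBlDr addrC -lerBlDr -opprB -(pint_FTC (ltW ts) ch' hh').
  apply: (@le_trans _ _ (pint t s (fun s => `|h' s|))).
    rewrite -mulN1r -pintZ//; apply: le_pint => //.
      by apply: continuous_mulr => //; exact: continuous_constr.
    by move=> x _; rewrite mulN1r -normrN ler_norm.
  exact: le_pint_subset.
rewrite pintD// -lerBlDr.
rewrite -[leLHS]mulr1 -{2}(subr0 1) -pint_cst//.
by apply: le_pint => //; exact: continuous_constr.
Qed.

End sobolev.

Section sobolev_torus.
Context {R : realType} {n : nat}.
Implicit Types (f : 'rV[R]_n -> R).

Lemma upd_add (x : 'rV[R]_n) k s t : upd x k (s + t) = upd x k s + t *: delta_mx 0 k.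
Proof.
apply/rowP => j; rewrite !mxE eqxx/=.
by case: eqP => _; rewrite ?mulr1// mulr0 addr0.
Qed.

(** In each of the n directions f^(1/(n-1)) is bounded by the same power of [avg i (G i)]; the
    product has exponent n/(n-1). The i-th bound is constant in direction i, as [loomis_whitney]
    requires. *)
Lemma tint_sobolev11 f (Df : 'I_n -> 'rV[R]_n -> R) (S : R) :
  (1 < n)%N -> continuous f -> (forall i, continuous (Df i)) ->
  (forall x, 1 <= f x) -> zperiodic f ->
  (forall i x (s : R), is_derive s 1 (fun t => f (upd x i t)) (Df i (upd x i s))) ->
  (forall i, tint (fun x => f x + `|Df i x|) <= S) ->
  tint (fun x => f x `^ (n%:R / (n%:R - 1))) <= S `^ (n%:R / (n%:R - 1)).
Proof.
move=> n1 cf cD f1 fp fD fS.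
have n10 : 0 < n%:R - 1 :> R by rewrite subr_gt0 ltr1n.
pose G i x := f x + `|Df i x|.
have cG i : continuous (G i) by apply: continuous_addr => //; exact: continuous_normr.
have G1 i x : 1 <= G i x by rewrite -[1]addr0 lerD.
pose a : R := (n%:R - 1)^-1.
have a0 : 0 <= a by rewrite invr_ge0 ltW.
have f0 x : 0 < f x := lt_le_trans ltr01 (f1 x).
have prodE (y : R) : 0 < y -> \prod_(i < n) y `^ a = y `^ (n%:R / (n%:R - 1)).
  by move=> y0; rewrite prodr_const card_ord -powR_mulrn ?powR_ge0// -powRrM mulrC.
have ag1 i x : 1 <= avg i (G i) x by apply: (pf_ge1 (positive_functional_avg i x)).
apply: (@le_trans _ _ (tint (fun x => \prod_i avg i (G i) x `^ a))).
  apply: le_tint.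
  - exact: continuous_powR.
  - apply: continuous_bigprod => i _; apply: continuous_powR; first exact: continuous_avg.
    by move=> x; exact: lt_le_trans ltr01 (ag1 i x).
  move=> x; rewrite -prodE//; apply: ler_prod => i _; rewrite powR_ge0/=.
  apply: ge0_ler_powR => //; rewrite ?nnegrE ?(ltW (f0 _))//.
    exact: le_trans ler01 (ag1 i x).
  rewrite -{1}(upd_id x i).
  apply: (le_pint_periodic (h := fun s => f (upd x i s)) (h' := fun s => Df i (upd x i s))) => //.
    apply: continuous_compr (cD i).
    exact: (continuous_pair1 (x := x) (@continuous_upd R n i)).
  by move=> s; rewrite upd_add scale1r fp.
apply: (le_trans (loomis_whitney a0 _ _ ag1 _)).
- by rewrite mulVf// gt_eqF.
- by move=> i; exact: continuous_avg.
- by move=> i; exact: indep_avg_id.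
have tG1 i : 1 <= tint (G i) by exact: (pf_ge1 (positive_functional_tint n)).
have S0 : 0 < S.
  by apply: lt_le_trans ltr01 _; exact: le_trans (tG1 (Ordinal (ltnW n1))) (fS _).
rewrite -prodE//; apply: ler_prod => i _; rewrite powR_ge0/=.
rewrite tint_avg//; apply: ge0_ler_powR => //; rewrite ?nnegrE.
- exact: le_trans ler01 (tG1 i).
- exact: ltW.
- exact: fS.
Qed.

End sobolev_torus.

Section gagliardo_nirenberg.
Context {R : realType} {n : nat}.
Implicit Types (f g w : 'rV[R]_n -> R).

Lemma powR_ge1 (x a : R) : 1 <= x -> 0 <= a -> 1 <= x `^ a.
Proof. by move=> x1 a0; rewrite -(powRr0 x) ler_powR. Qed.

Lemma tint_hoelder2 f g (a b : R) : 0 <= a -> 0 <= b -> a + b = 1 ->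
  continuous f -> continuous g -> (forall x, 1 <= f x) -> (forall x, 1 <= g x) ->
  tint (fun x => f x `^ a * g x `^ b) <= tint f `^ a * tint g `^ b.
Proof.
move=> a0 b0 ab cf cg f1 g1.
have := @generalized_hoelder R _ _ bool predT (fun c => if c then a else b)
  (fun c => if c then f else g) (positive_functional_tint n).
rewrite !big_bool/=.
under [X in tint X]funext do rewrite big_bool/=.
by apply => //; case.
Qed.

Lemma tint_ge1 f : continuous f -> (forall x, 1 <= f x) -> 1 <= tint f.
Proof. exact: pf_ge1 (positive_functional_tint n). Qed.

Lemma ln_tint_hoelder2 f g (a b : R) : 0 <= a -> 0 <= b -> a + b = 1 ->
  continuous f -> continuous g -> (forall x, 1 <= f x) -> (forall x, 1 <= g x) ->
  ln (tint (fun x => f x `^ a * g x `^ b)) <= a * ln (tint f) + b * ln (tint g).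
Proof.
move=> a0 b0 ab cf cg f1 g1; rewrite -!ln_powR -lnM ?posrE; last 2 first.
- by rewrite powR_gt0// (lt_le_trans ltr01)// tint_ge1.
- by rewrite powR_gt0// (lt_le_trans ltr01)// tint_ge1.
have H := tint_hoelder2 a0 b0 ab cf cg f1 g1.
rewrite ler_ln ?posrE//.
  rewrite (lt_le_trans ltr01)// tint_ge1// => [|x].
    by apply: continuous_mulr; apply: continuous_powR => // x; exact: lt_le_trans ltr01 _.
  by rewrite -[1](mulr1 1) ler_pM// powR_ge1.
by rewrite mulr_gt0// powR_gt0// (lt_le_trans ltr01)// tint_ge1.
Qed.

(** Derivatives are asked for along coordinate lines, the form used by the one-dimensional bounds.
    The lower bound 1 keeps the integrals of nonnegative powers of [w] at least 1, ready for
    logarithms. *)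
Record C1_ge1 w (Dw : 'I_n -> 'rV[R]_n -> R) : Prop := {
  C1_ge1_cont : continuous w;
  C1_ge1_contD : forall i, continuous (Dw i);
  C1_ge1_ge1 : forall x, 1 <= w x;
  C1_ge1_periodic : zperiodic w;
  C1_ge1_derive : forall i x (s : R),
    is_derive s 1 (fun t => w (upd x i t)) (Dw i (upd x i s)) }.

Definition grad2 (Dw : 'I_n -> 'rV[R]_n -> R) : R :=
  \sum_i tint (fun x => Dw i x ^+ 2).

(* Gagliardo's trick: [tint_sobolev11] applied to [w^sg] with [sg = 2(n-1)/(n-2)]. *)
Lemma tint_sobolev12 w Dw : C1_ge1 w Dw -> (2 < n)%N ->
  (n%:R - 2) / n%:R * ln (tint (fun x => w x `^ (2 * n%:R / (n%:R - 2)))) <=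
  2 * ln (1 + 2 * (n%:R - 1) / (n%:R - 2)) +
  ln (tint (fun x => w x ^+ 2) + grad2 Dw).
Proof.
move=> [cw cD w1 pw wD] n2.
have N2 : 2 < n%:R :> R by rewrite ltr_nat.
have [N NE] : {N : R | N = n%:R} by exists n%:R.
rewrite -NE in N2 *.
have w0 x : 0 < w x := lt_le_trans ltr01 (w1 x).
(* With this [sg], f^(N/(N-1)) is w^P for the critical exponent P = 2N/(N-2), and the factor
   w^(sg-1) of the derivative of w^sg is w^(P/2). *)
have [sg sgE] : {sg | sg = 2 * (N - 1) / (N - 2)} by eexists.
have [P PE] : {P | P = 2 * N / (N - 2)} by eexists.
rewrite -PE -sgE.
have sg0 : 0 < sg by rewrite sgE divr_gt0 ?mulr_gt0//; lra.
have Psg : P / 2 = sg - 1 by rewrite PE sgE; field; lra.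
have sgP : sg * (N / (N - 1)) = P by rewrite PE sgE; field; lra.
pose f x := w x `^ sg; pose Df i x := sg * w x `^ (sg - 1) * Dw i x.
have cws a : continuous (fun x => w x `^ a) by exact: continuous_powR.
have cw2 : continuous (fun x => w x ^+ 2) by exact: continuous_mulr.
have cD2 i : continuous (fun x => Dw i x ^+ 2) by apply: continuous_mulr; exact: cD.
pose Z := tint (fun x => w x `^ P); pose G := tint (fun x => w x ^+ 2) + grad2 Dw.
have wpow1 a x : 0 <= a -> 1 <= w x `^ a.
  exact: powR_ge1.
have P0 : 0 <= P by rewrite PE ltW// divr_gt0//; lra.
have Z1 : 1 <= Z by apply: tint_ge1 => // x; exact: wpow1.
have w21 x : 1 <= w x ^+ 2 by rewrite exprn_ege1.
have gi0 i : 0 <= tint (fun x => Dw i x ^+ 2).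
  by apply: tint_ge0 => x; exact: sqr_ge0.
have G1 : 1 <= G.
  by rewrite -[1]addr0 lerD//; [exact: tint_ge1|apply: sumr_ge0 => i _].
have Z0 := lt_le_trans ltr01 Z1; have G0 := lt_le_trans ltr01 G1.
(* Both w and |Dw i| are at most (w^2 + (Dw i)^2)^(1/2), so f + |Df i| is at most (1 + sg) w^(P/2)
   times this root; Cauchy-Schwarz then gives [S]. *)
pose S := (1 + sg) * (Z `^ 2^-1 * G `^ 2^-1).
have S0 : 0 < S by rewrite !mulr_gt0 ?powR_gt0//; lra.
have fS i : tint (fun x => f x + `|Df i x|) <= S.
  pose gi x := w x ^+ 2 + Dw i x ^+ 2.
  have cgi : continuous gi by exact: continuous_addr.
  have gi1 x : 1 <= gi x by rewrite -[1]addr0 lerD// sqr_ge0.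
  have gi0' x : 0 < gi x := lt_le_trans ltr01 (gi1 x).
  have h0 : (0 : R) <= 2^-1 by [].
  have h1 : 2^-1 + 2^-1 = 1 :> R by lra.
  have H := tint_hoelder2 h0 h0 h1 (cws P) cgi (fun x => wpow1 P x P0) gi1.
  apply: (@le_trans _ _ ((1 + sg) * tint (fun x => (w x `^ P) `^ 2^-1 * gi x `^ 2^-1))).
    rewrite -tintZ; last first.
      apply: continuous_mulr; last exact: continuous_powR.
      by apply: continuous_powR => // x; rewrite powR_gt0.
    apply: le_tint.
    - apply: continuous_addr; first exact: cws.
      apply: continuous_normr; apply: continuous_mulr; last exact: cD.
      by apply: continuous_mulr; [exact: continuous_constr|exact: cws].
    - apply: continuous_mulr; first exact: continuous_constr.
      apply: continuous_mulr; last exact: continuous_powR.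
      by apply: continuous_powR => // x; rewrite powR_gt0.
    move=> x; rewrite /f /Df -powRrM.
    rewrite Psg; have -> : w x `^ sg = w x `^ (sg - 1) * w x.
      by rewrite mulrC mulr_powRB1// ltW.
    rewrite !normrM (gtr0_norm sg0) (ger0_norm (powR_ge0 _ _)).
    have -> : w x `^ (sg - 1) * w x + sg * w x `^ (sg - 1) * `|Dw i x| =
      w x `^ (sg - 1) * (w x + sg * `|Dw i x|) by ring.
    rewrite mulrCA ler_wpM2l ?powR_ge0// powR12_sqrt ?(ltW (gi0' x))// mulrDl mul1r.
    have q1 : w x <= Num.sqrt (gi x).
      by rewrite -(ger0_norm (ltW (w0 x))) -sqrtr_sqr ler_sqrt ?(ltW (gi0' x))// /gi lerDl sqr_ge0.
    have q2 : `|Dw i x| <= Num.sqrt (gi x).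
      by rewrite -sqrtr_sqr ler_sqrt ?(ltW (gi0' x))// /gi lerDr sqr_ge0.
    by rewrite lerD// ler_wpM2l// ltW.
  rewrite ler_wpM2l//; first by rewrite addr_ge0// ltW.
  apply: (le_trans H); rewrite ler_wpM2l ?powR_ge0// ge0_ler_powR ?nnegrE ?(ltW G0)//.
    by rewrite (le_trans ler01)// tint_ge1.
  rewrite tintD// lerD2l /grad2 (bigD1 i)//= lerDl.
  by apply: sumr_ge0.
have := @tint_sobolev11 R n f Df S _ (cws sg) _ _ _ _ fS.
have -> : (fun x => f x `^ (n%:R / (n%:R - 1))) = (fun x => w x `^ P).
  by apply/funext => x; rewrite /f -powRrM -NE sgP.
rewrite -/Z -NE => H.
have {H} : Z <= S `^ (N / (N - 1)).
  apply: H.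
  - exact: ltnW.
  - move=> i; apply: continuous_mulr; last exact: cD.
    by apply: continuous_mulr; [exact: continuous_constr|exact: cws].
  - by move=> x; exact/wpow1/ltW.
  - by move=> i x; rewrite /f pw.
  move=> i x s; rewrite /Df.
  have H1 := wD i x s.
  have H2 := is_derive1_powR sg (w0 (upd x i s)).
  exact: (is_derive1_comp (f := fun y => y `^ sg) (g := fun t => w (upd x i t))).
rewrite -ler_ln ?posrE ?powR_gt0// ln_powR lnM ?posrE ?mulr_gt0 ?powR_gt0//; last by lra.
rewrite lnM ?posrE ?powR_gt0// !ln_powR -/Z -/G.
move: (ln Z) (ln G) (ln (1 + sg)) => z g c H.
(* Moving z/2 to the left leaves the coefficient N - 1 - N/2 = (N - 2)/2 of z, positive because N >
   2. *)
have {}H : z * (N - 1) <= N * (c + (2^-1 * z + 2^-1 * g)).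
  by move: H; rewrite mulrAC ler_pdivlMr//; lra.
rewrite mulrAC ler_pdivrMr; last by lra.
nra.
Qed.

End gagliardo_nirenberg.

(** * Interpolation of exponents and Young's inequality *)

Section interpolation.
Context {R : realType} {n : nat}.
Implicit Types (w : 'rV[R]_n -> R).

(* The [kappa] of the theorem: it is [1 - a], where
   [1 / (2 q) = (1 - a) (theta / 2) + a (N - 2) / (2 N)]. *)
Definition gn_exponent (N q theta : R) : R :=
  (N + 2 * q - N * q) / (q * ((theta - 1) * N + 2)).

Lemma gn_exponent_bounds (N q theta : R) : 2 < N -> 1 < theta -> 1 <= q ->
  q * (N - 2) < N -> 0 < gn_exponent N q theta < 1.
Proof.
move=> N2 t1 q1 qN; have q0 : 0 < q by lra.
have t0 : 0 < (theta - 1) * N by rewrite mulr_gt0//; lra.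
have D0 : 0 < q * ((theta - 1) * N + 2) by rewrite mulr_gt0//; lra.
apply/andP; split; first by rewrite divr_gt0//; lra.
rewrite ltr_pdivrMr// mul1r.
have : 0 <= N * (q - 1) by rewrite mulr_ge0//; lra.
have : 0 < q * ((theta - 1) * N) by rewrite mulr_gt0.
lra.
Qed.

(** The condition p > N/2 reads 1/q > (N - 2)/N: the exponent 2q stays below the critical Sobolev
    exponent 2N/(N-2). *)
Lemma conjugate_exponent_bounds (N p q : R) : 2 < N -> N / 2 < p ->
  p^-1 + q^-1 = 1 -> [/\ 0 < p, 1 <= q & q * (N - 2) < N].
Proof.
move=> N2 np pq.
have p1 : 1 < p by apply: le_lt_trans np; rewrite ler_pdivlMr// mul1r ltW.
have p0 : 0 < p by exact: lt_trans p1.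
have qV : q^-1 = 1 - p^-1 by rewrite -pq addrC addKr.
have qV0 : 0 < q^-1 by rewrite qV subr_gt0 invf_lt1.
have q0 : 0 < q by rewrite -invr_gt0.
split => //; first by rewrite -invf_le1// qV gerBl invr_ge0 ltW.
have : N * p^-1 < 2 by rewrite ltr_pdivrMr// -ltr_pdivrMl// mulrC.
have : q * q^-1 = 1 by rewrite mulfV// gt_eqF.
rewrite qV; move: (p^-1) => v qE v2.
have : 0 < q * (2 - N * v) by rewrite mulr_gt0// subr_gt0.
nra.
Qed.

Lemma gn_exponent_gt0 (p q theta : R) : (2 < n)%N -> n%:R / 2 < p ->
  p^-1 + q^-1 = 1 -> 1 < theta -> 0 < gn_exponent n%:R q theta.
Proof.
move=> n2 np pq t1; have N2 : 2 < n%:R :> R by rewrite ltr_nat.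
have [_ q1 qn] := conjugate_exponent_bounds N2 np pq.
by have /andP[] := gn_exponent_bounds N2 t1 q1 qn.
Qed.

Lemma ln_tint_interpolation w (Dw : 'I_n -> 'rV[R]_n -> R) (q theta k : R) :
  C1_ge1 w Dw -> (2 < n)%N -> 1 < theta -> 1 <= q -> q * (n%:R - 2) < n%:R ->
  k = gn_exponent n%:R q theta ->
  q^-1 * ln (tint (fun x => w x `^ (2 * q))) <=
  theta * k * ln (tint (fun x => w x `^ (2 / theta))) +
  (1 - k) * (2 * ln (1 + 2 * (n%:R - 1) / (n%:R - 2)) +
             ln (tint (fun x => w x ^+ 2) + grad2 Dw)).
Proof.
move=> cw n2 t1 q1 qn kE.
have N2 : 2 < n%:R :> R by rewrite ltr_nat.
have /andP[k0 k1] := gn_exponent_bounds N2 t1 q1 qn.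
have H12 := tint_sobolev12 cw n2.
have [c cE] : {c : R | c = 2 * ln (1 + 2 * (n%:R - 1) / (n%:R - 2))} by eexists.
have [lG lGE] : {l : R | l = ln (tint (fun x => w x ^+ 2) + grad2 Dw)} by eexists.
move: H12; rewrite -cE -lGE; rewrite -kE in k0 k1.
move: (n%:R : R) N2 qn kE {cE} => N N2 qn kE.
set P := 2 * N / (N - 2); move=> H12.
have q0 : 0 < q by lra.
have t0 : 0 < theta by lra.
have N0 : 0 < N by lra.
have N20 : 0 < N - 2 by lra.
have D0 : 0 < (theta - 1) * N + 2.
  suff : 0 < (theta - 1) * N by lra.
  by rewrite mulr_gt0//; lra.
(* These weights combine the exponents 2/theta and P to 2q whatever [k] is; that they add up to 1 is
   the equation determining [k]. *)
pose al := k * theta * q; pose ga := q * (1 - k) * ((N - 2) / N).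
have al0 : 0 <= al by rewrite !mulr_ge0//; lra.
have ga0 : 0 <= ga by rewrite !mulr_ge0// ?invr_ge0; lra.
have alga : al + ga = 1.
  by rewrite /al /ga kE /gn_exponent; field; rewrite !gt_eqF.
have P0 : 0 <= P by rewrite ltW// divr_gt0//; lra.
have expE : 2 / theta * al + P * ga = 2 * q.
  by rewrite /al /ga /P; field; rewrite !gt_eqF.
case: cw => cw _ w1 _ _.
have w0 x : 0 < w x := lt_le_trans ltr01 (w1 x).
have t20 : 0 <= 2 / theta by rewrite divr_ge0// ltW.
have cwp a : continuous (fun x => w x `^ a) by exact: continuous_powR.
have := ln_tint_hoelder2 al0 ga0 alga (cwp (2 / theta)) (cwp P)
  (fun x => powR_ge1 (w1 x) t20) (fun x => powR_ge1 (w1 x) P0).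
have -> : (fun x => (w x `^ (2 / theta)) `^ al * (w x `^ P) `^ ga) =
    (fun x => w x `^ (2 * q)).
  apply/funext => x; rewrite -!powRrM -powRD ?expE//.
  by apply/implyP => _; rewrite gt_eqF.
move: H12.
move: (ln (tint (fun x => w x `^ P))) (ln (tint (fun x => w x `^ (2 / theta))))
  (ln (tint (fun x => w x `^ (2 * q)))) => z y v H12 H.
rewrite mulrC ler_pdivrMr//; apply: (le_trans H).
have : q * (1 - k) * ((N - 2) / N * z) <= q * (1 - k) * (c + lG).
  rewrite ler_wpM2l// mulr_ge0//; first exact: ltW.
  by rewrite subr_ge0 ltW.
by move: H; rewrite /al /ga; lra.
Qed.

(** Here [l] stands for ln e, [b] for ln B, [y] and [g] for logarithms of integrals. Weight 1 - k is
    to carry exactly e G, so the rest of the constant and all of B go to weight k; division by k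
    produces B^(1/k) and the constant [mu] below. *)
Lemma young_exponents (k t c l b y g z : R) : 0 < k ->
  z <= t * k * y + (1 - k) * (c + g) ->
  b + z <= k * ((1 - k) * (c - l) / k + k^-1 * b + t * y) + (1 - k) * (l + g).
Proof.
move=> k0 H.
have -> : k * ((1 - k) * (c - l) / k + k^-1 * b + t * y) =
    (1 - k) * (c - l) + b + t * k * y by field; rewrite gt_eqF.
lra.
Qed.

(** Young's inequality with constant 1: a convex combination is at most the larger of [u] and [v],
    and the sum of the exponentials exceeds each of them. *)
Lemma expR_convex_le (k u v z : R) : 0 < k < 1 -> z <= k * u + (1 - k) * v ->
  expR z <= expR v + expR u.
Proof.
move=> /andP[k0 k1] uv; have [le_uv|lt_vu] := leP u v.
  have h : z <= v.
    have : 0 <= k * (v - u) by rewrite mulr_ge0// ?subr_ge0// ltW.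
    lra.
  by rewrite -[leLHS]addr0 lerD ?expR_ge0// ler_expR.
have h : z <= u.
  have : 0 <= (1 - k) * (u - v) by rewrite mulr_ge0// ?subr_ge0// ltW.
  lra.
by rewrite -[leLHS]add0r lerD ?expR_ge0// ler_expR.
Qed.

Lemma gagliardo_nirenberg_young_full (q theta e : R) :
  (2 < n)%N -> 1 < theta -> 1 <= q -> q * (n%:R - 2) < n%:R -> 0 < e ->
  exists2 K : R, 0 <= K &
    forall w Dw (B : R), C1_ge1 w Dw -> 0 <= B ->
    B * tint (fun x => w x `^ (2 * q)) `^ q^-1 <=
    e * (tint (fun x => w x ^+ 2) + grad2 Dw) +
    K * B `^ (gn_exponent n%:R q theta)^-1 *
      tint (fun x => w x `^ (2 / theta)) `^ theta.
Proof.
move=> n2 t1 q1 qn e0.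
have N2 : 2 < n%:R :> R by rewrite ltr_nat.
have /andP[k0 k1] := gn_exponent_bounds N2 t1 q1 qn.
set k := gn_exponent _ _ _ in k0 k1 *.
pose c : R := 2 * ln (1 + 2 * (n%:R - 1) / (n%:R - 2)).
pose mu := (1 - k) * (c - ln e) / k.
exists (expR mu); first exact: expR_ge0.
move=> w Dw B Cw; have [cw cD w1 _ _] := Cw.
have w0 x : 0 < w x := lt_le_trans ltr01 (w1 x).
have cwp a : continuous (fun x => w x `^ a) by exact: continuous_powR.
have T1 a : 0 <= a -> 0 < tint (fun x => w x `^ a).
  move=> a0; rewrite (lt_le_trans ltr01)//; apply: tint_ge1 => // x.
  exact: powR_ge1.
have q0 : 0 < q by lra.
have t0 : 0 < theta by lra.
have Y0 : 0 < tint (fun x => w x `^ (2 / theta)) by apply: T1; rewrite divr_ge0// ltW.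
have V0 : 0 < tint (fun x => w x `^ (2 * q)) by apply: T1; rewrite mulr_ge0// ltW.
have G0 : 0 < tint (fun x => w x ^+ 2) + grad2 Dw.
  rewrite ltr_pwDl//; last first.
    by apply: sumr_ge0 => i _; apply: tint_ge0 => x; exact: sqr_ge0.
  by apply: lt_le_trans ltr01 _; apply: tint_ge1 => [|x];
    [exact: continuous_mulr|rewrite exprn_ege1].
(* B = 0 is set apart for want of a logarithm; 0 to the nonzero power 1/k is 0. *)
rewrite le_eqVlt => /predU1P[<-|B0].
  by rewrite mul0r powR0 ?invr_eq0 ?gt_eqF// mulr0 mul0r addr0 mulr_ge0// ltW.
have := ln_tint_interpolation Cw n2 t1 q1 qn (erefl k); rewrite -/c.
set V := tint (fun x => w x `^ (2 * q)) in V0 *.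
set Y := tint (fun x => w x `^ (2 / theta)) in Y0 *.
set G := tint _ + _ in G0 * => H.
pose u := mu + k^-1 * ln B + theta * ln Y; pose v := ln e + ln G.
have -> : expR mu * B `^ k^-1 * Y `^ theta = expR u.
  by rewrite /u !expRD /powR !gt_eqF.
have -> : e * G = expR v by rewrite expRD !lnK.
have -> : B * V `^ q^-1 = expR (ln B + q^-1 * ln V).
  by rewrite expRD lnK ?posrE// /powR gt_eqF.
apply: (@expR_convex_le k); first by rewrite k0.
exact: young_exponents.
Qed.

(* The zero-order part [tint w^2] of the [H^1] norm is itself absorbed by the
   same inequality with [q = 1] and [B = 1]. *)
Lemma gagliardo_nirenberg_young (q theta e : R) :
  (2 < n)%N -> 1 < theta -> 1 <= q -> q * (n%:R - 2) < n%:R -> 0 < e ->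
  exists2 K : R, 0 <= K &
    forall w Dw (B : R), C1_ge1 w Dw -> 0 <= B ->
    B * tint (fun x => w x `^ (2 * q)) `^ q^-1 <=
    e * grad2 Dw + K * (1 + B `^ (gn_exponent n%:R q theta)^-1) *
      tint (fun x => w x `^ (2 / theta)) `^ theta.
Proof.
move=> n2 t1 q1 qn e0.
have N2 : 2 < n%:R :> R by rewrite ltr_nat.
have e20 : 0 < e / 2 by rewrite divr_gt0.
have h0 : (0 : R) < 2^-1 by [].
have [K K0 HK] := gagliardo_nirenberg_young_full n2 t1 q1 qn e20.
have one : 1 * (n%:R - 2) < n%:R :> R by rewrite mul1r; lra.
have [K1 K10 HK1] := gagliardo_nirenberg_young_full n2 t1 (lexx 1) one h0.
(* With W the integral of w^2 and D = [grad2 Dw], the case q = B = 1 gives W <= D + 2 K1 Y. Inserted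
   with weight e/2, it raises the weight of D to e and costs e K1 Y. *)
exists (e * K1 + K); first by rewrite addr_ge0// mulr_ge0// ltW.
move=> w Dw B Cw B0; have {}HK := HK w Dw B Cw B0.
have := HK1 w Dw 1 Cw ler01.
rewrite powR1 invr1 mul1r !mulr1.
have -> : (fun x => w x `^ 2) = (fun x => w x ^+ 2).
  apply/funext => x; rewrite -powR_mulrn// ltW// (lt_le_trans ltr01)//.
  by case: Cw.
set Y := tint (fun x => w x `^ (2 / theta)) `^ theta in HK *.
have T0 : 0 <= tint (fun x => w x ^+ 2) by apply: tint_ge0 => x; exact: sqr_ge0.
rewrite powRr1//.
have Y0 : 0 <= Y by exact: powR_ge0.
move: HK; set Br := B `^ _; have Br0 : 0 <= Br by exact: powR_ge0.
set V := B * _; move: (tint _) (grad2 _) T0 => W D W0 HK H1.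
have a1 : e / 2 * (2 * (2^-1 * (W + D) + K1 * Y) ) >= e / 2 * (2 * W).
  by rewrite !ler_wpM2l// ltW.
have a2 : 0 <= e * K1 * Br * Y by rewrite !mulr_ge0// ltW.
have a3 : 0 <= K * Y by rewrite mulr_ge0.
by nra.
Qed.

End interpolation.

(** * Calculus on the torus and the energy estimate *)

Section partial_derivatives.
Context {R : realType}.

(** A directional derivative sees only the restriction to a line. This carries derivatives between
    coordinate lines, space, space-time and phase space. *)
Lemma derivative_reparam (U V : normedModType R) (f : U -> R) (g : V -> R) a v b w :
  (forall h : R, f (h *: v + a) = g (h *: w + b)) ->
  ((derivable f a v = derivable g b w) * ('D_v f a = 'D_w g b))%type.
Proof.
move=> fg; have fgab : f a = g b by have := fg 0; rewrite !scale0r !add0r.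
have E : (fun h : R => h^-1 *: ((f \o shift a) (h *: v) - f a)) =
         (fun h : R => h^-1 *: ((g \o shift b) (h *: w) - g b)).
  by apply/funext => h /=; rewrite fg fgab.
by rewrite /derivable /derive E.
Qed.

(** Stated along whole coordinate lines, so that one-variable rules and [pint_FTC] apply
    directly. *)
Definition has_partial n (i : 'I_n) (f Df : 'rV[R]_n -> R) :=
  forall x (s : R), is_derive s 1 (fun t => f (upd x i t)) (Df (upd x i s)).

Lemma updE n (x : 'rV[R]_n) i (h s : R) :
  upd x i (h *: 1 + s) = h *: delta_mx 0 i + upd x i s.
Proof. by rewrite -[h *: 1]/(h * 1) mulr1 addrC upd_add addrC. Qed.

Lemma derivable_has_partial n (i : 'I_n) (f : 'rV[R]_n -> R) :
  (forall x, derivable f x (delta_mx 0 i)) -> has_partial i f ('D_(delta_mx 0 i) f).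
Proof.
move=> df x s.
have [E1 E2] := @derivative_reparam R^o 'rV[R]_n (fun t => f (upd x i t)) f s 1
  (upd x i s) (delta_mx 0 i) (fun h => congr1 f (updE x i h s)).
by split; [rewrite E1; exact: df|rewrite E2].
Qed.

Lemma has_partialE n (i : 'I_n) (f Df : 'rV[R]_n -> R) x :
  has_partial i f Df -> 'D_(delta_mx 0 i) f x = Df x.
Proof.
move=> /(_ x (x 0 i)); rewrite upd_id => -[_ <-]; apply: esym.
have [_ E] := @derivative_reparam R^o 'rV[R]_n (fun t => f (upd x i t)) f (x 0 i) 1
  (upd x i (x 0 i)) (delta_mx 0 i) (fun h => congr1 f (updE x i h (x 0 i))).
by rewrite E upd_id.
Qed.

Lemma has_partialM n (i : 'I_n) (f g Df Dg : 'rV[R]_n -> R) :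
  has_partial i f Df -> has_partial i g Dg ->
  has_partial i (fun x => f x * g x) (fun x => f x * Dg x + g x * Df x).
Proof. by move=> hf hg x s; have := is_deriveM (hf x s) (hg x s). Qed.

Lemma has_partialD n (i : 'I_n) (f g Df Dg : 'rV[R]_n -> R) :
  has_partial i f Df -> has_partial i g Dg ->
  has_partial i (fun x => f x + g x) (fun x => Df x + Dg x).
Proof. by move=> hf hg x s; have := is_deriveD (hf x s) (hg x s). Qed.

Lemma has_partial_comp n (i : 'I_n) (f Df : 'rV[R]_n -> R) (phi dphi : R -> R) :
  (forall y : R, is_derive y 1 phi (dphi y)) -> has_partial i f Df ->
  has_partial i (fun x => phi (f x)) (fun x => dphi (f x) * Df x).
Proof.
move=> hp hf x s.
exact: (is_derive1_comp (f := phi) (g := fun t => f (upd x i t))).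
Qed.

(** Already the average along each line in direction [i] vanishes, being the increment of [f] over
    one period. *)
Lemma tint_partial n (i : 'I_n) (f Df : 'rV[R]_n -> R) :
  has_partial i f Df -> continuous Df -> zperiodic f -> tint Df = 0.
Proof.
move=> hf cD pf; rewrite -(tint_avg i cD) -[RHS](tint_cst n).
apply: congr1; apply/funext => x.
have cDu : continuous (fun s => Df (upd x i s)).
  apply: continuous_compr cD.
  exact: (continuous_pair1 (x := x) (@continuous_upd R n i)).
rewrite /avg (pint_FTC ler01 cDu (hf x)).
by rewrite -[1]add0r upd_add scale1r pf subrr.
Qed.

Lemma tint_by_parts n (i : 'I_n) (f g Df Dg : 'rV[R]_n -> R) :
  has_partial i f Df -> has_partial i g Dg ->
  continuous f -> continuous g -> continuous Df -> continuous Dg ->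
  zperiodic f -> zperiodic g ->
  tint (fun x => f x * Dg x) = - tint (fun x => Df x * g x).
Proof.
move=> hf hg cf cg cDf cDg pf pg; apply/eqP; rewrite -addr_eq0; apply/eqP.
rewrite -tintD; [|exact: continuous_mulr|exact: continuous_mulr].
have := tint_partial (has_partialM hf hg) _ _.
under [X in tint X]funext do rewrite (mulrC (g _)); apply.
  by apply: continuous_addr; exact: continuous_mulr.
by move=> k x; rewrite pf pg.
Qed.

Lemma zperiodic_partial n (i : 'I_n) (f Df : 'rV[R]_n -> R) :
  has_partial i f Df -> zperiodic f -> zperiodic Df.
Proof.
move=> hf pf k x; rewrite -!(has_partialE _ hf).
have fk (h : R) : f (h *: delta_mx 0 i + (x + delta_mx 0 k)) =
    f (h *: delta_mx 0 i + x) by rewrite addrA pf.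
by have [_ ->] := derivative_reparam fk.
Qed.

Lemma is_derive_comp_diff (W : normedModType R) (g : W -> R) (c : R -> W) (s : R) (dc : W) :
  differentiable g (c s) -> is_derive s 1 c dc ->
  is_derive s 1 (fun t => g (c t)) ('D_dc g (c s)).
Proof.
move=> dg [dcs cE]; have dc' : differentiable c s by apply/derivable1_diffP.
have dgc : differentiable (g \o c) s by exact: differentiable_comp.
split; first exact: diff_derivable.
by rewrite !deriveE// diff_comp//= -cE deriveE.
Qed.

Lemma is_derive_pair (V W : normedModType R) (c1 : R -> V) (c2 : R -> W) (s : R) d1 d2 :
  is_derive s 1 c1 d1 -> is_derive s 1 c2 d2 ->
  is_derive s 1 (fun t => (c1 t, c2 t)) (d1, d2).
Proof.
move=> [h1 <-] [h2 <-].
have g1 : differentiable c1 s by apply/derivable1_diffP.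
have g2 : differentiable c2 s by apply/derivable1_diffP.
have g12 : differentiable (fun t => (c1 t, c2 t)) s by exact: differentiable_pair.
split; first exact: diff_derivable.
by rewrite !deriveE// diff_pair.
Qed.

Lemma is_derive_row n (c : 'I_n -> R -> R) (d : 'I_n -> R) (s : R) :
  (forall k, is_derive s 1 (c k) (d k)) ->
  is_derive s 1 (fun t => \row_k c k t) (\row_k d k).
Proof.
move=> h.
have dc : derivable (fun t => \row_k c k t) s 1.
  apply/derivable_mxP => i j.
  under [X in derivable X _ _]funext do rewrite mxE.
  by have [] := h j.
split => //; apply/rowP => j; rewrite derive_mx// !mxE.
under [X in 'D__ X _]funext do rewrite mxE.
by have [] := h j.
Qed.

End partial_derivatives.

Section smooth_functions.
Context {R : realType}.

Lemma smooth_differentiable (V : normedModType R) (f : V -> R) x :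
  smooth f -> differentiable f x.
Proof. by move=> /(_ [::] x). Qed.

Lemma smooth_continuous (V : normedModType R) (f : V -> R) : smooth f -> continuous f.
Proof. by move=> sf x; apply: differentiable_continuous; exact: smooth_differentiable. Qed.

Lemma smooth_derive (V : normedModType R) (f : V -> R) v : smooth f -> smooth ('D_v f).
Proof. by move=> sf vs x; have := sf (rcons vs v) x; rewrite foldr_rcons. Qed.

Lemma continuous_derive (V : normedModType R) (f : V -> R) v :
  smooth f -> continuous ('D_v f).
Proof. by move=> sf; apply: smooth_continuous; exact: smooth_derive. Qed.

Context {n : nat}.
Implicit Type F : 'rV[R]_n * R -> R.

Definition dx (i : 'I_n) F : 'rV[R]_n * R -> R := 'D_((delta_mx 0 i, 0)) F.
Definition dt F : 'rV[R]_n * R -> R := 'D_((0, 1)) F.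

Lemma smooth_dx i F : smooth F -> smooth (dx i F).
Proof. exact: smooth_derive. Qed.

Lemma derivative_dx i F x t : smooth F ->
  derivable (fun y => F (y, t)) x (delta_mx 0 i) /\
  'D_(delta_mx 0 i) (fun y => F (y, t)) x = dx i F (x, t).
Proof.
move=> sF.
have [E1 E2] := @derivative_reparam R 'rV[R]_n ('rV[R]_n * R)%type
  (fun y => F (y, t)) F x (delta_mx 0 i) (x, t) (delta_mx 0 i, 0)
  (fun h => congr1 F (congr1 (pair (h *: delta_mx 0 i + x))
     (esym (etrans (congr1 (+%R^~ t) (scaler0 _ h)) (add0r t))))).
split; last exact: E2.
by rewrite E1; apply: diff_derivable; exact: smooth_differentiable.
Qed.

Lemma has_partial_dx i F t : smooth F ->
  has_partial i (fun y => F (y, t)) (fun y => dx i F (y, t)).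
Proof.
move=> sF; rewrite (_ : (fun y => dx i F (y, t)) = 'D_(delta_mx 0 i) (fun y => F (y, t))).
  by apply: derivable_has_partial => x; have [] := derivative_dx i x t sF.
by apply/funext => x; have [] := derivative_dx i x t sF.
Qed.

Lemma is_derive_dt F x t : smooth F ->
  is_derive (t : R) 1 (fun s => F (x, s)) (dt F (x, t)).
Proof.
move=> sF.
have [E1 E2] := @derivative_reparam R R^o ('rV[R]_n * R)%type
  (fun s => F (x, s)) F t 1 (x, t) (0, 1)
  (fun h => congr1 F (congr1 (pair^~ (h *: (1 : R^o) + t))
     (esym (etrans (congr1 (+%R^~ x) (scaler0 _ h)) (add0r x))))).
split; last exact: E2.
by rewrite E1; apply: diff_derivable; exact: smooth_differentiable.
Qed.

Lemma gradE F x t : smooth F -> grad (fun y => F (y, t)) x = \row_i dx i F (x, t).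
Proof. by move=> sF; apply/rowP => i; rewrite !mxE; have [] := derivative_dx i x t sF. Qed.

Lemma laplacianE F x t : smooth F ->
  laplacian (fun y => F (y, t)) x = \sum_i dx i (dx i F) (x, t).
Proof.
move=> sF; apply: eq_bigr => i _.
have [_ <-] := derivative_dx i x t (smooth_dx i sF).
apply: (congr1 (fun g => 'D_(delta_mx 0 i) g x)).
by apply/funext => y; rewrite gradE// mxE.
Qed.

End smooth_functions.

(** * The drift D_pH(x, Du) and its spatial derivatives *)

Section drift.
Context {R : realType} {n : nat}.
Local Notation V := 'rV[R]_n.
Context (H : V -> V -> R) (F : V * R -> R)
  (sH : smooth (fun z : V * V => H z.1 z.2)) (sF : smooth F).

Definition dp (i : 'I_n) : V * V -> R := 'D_((0, delta_mx 0 i)) (fun z : V * V => H z.1 z.2).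

(** Formed with the smooth extension [F] of u, hence continuous at all times; [DpH_drift] identifies
    it with [DpH] where the two agree. *)
Definition drift (i : 'I_n) (z : V * R) : R := dp i (z.1, \row_k dx k F z).

Definition ddrift (j i : 'I_n) (z : V * R) : R :=
  'D_((delta_mx 0 j, 0)) (dp i) (z.1, \row_k dx k F z) +
  \sum_k dx j (dx k F) z * 'D_((0, delta_mx 0 k)) (dp i) (z.1, \row_k dx k F z).

Lemma smooth_dp i : smooth (dp i).
Proof. exact: smooth_derive. Qed.

Let continuous_point : continuous (fun z : V * R => (z.1, \row_k dx k F z)).
Proof.
apply: continuous_mkpair; first by move=> z; exact: cvg_fst.
by apply: continuous_row => k; exact: continuous_derive.
Qed.

Lemma continuous_drift i : continuous (drift i).
Proof. exact: continuous_compr continuous_point (smooth_continuous (smooth_dp i)). Qed.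

Lemma continuous_ddrift j i : continuous (ddrift j i).
Proof.
apply: continuous_addr.
  exact: (continuous_compr (g := 'D_((delta_mx 0 j, 0)) (dp i)) continuous_point
    (continuous_derive (smooth_dp i))).
apply: continuous_bigsum => k _; apply: continuous_mulr.
  by apply: continuous_derive; exact: smooth_derive.
exact: (continuous_compr (g := 'D_((0, delta_mx 0 k)) (dp i)) continuous_point
  (continuous_derive (smooth_dp i))).
Qed.

Lemma is_derive_upd (x : V) j (s : R) : is_derive s 1 (upd x j) (delta_mx 0 j).
Proof.
rewrite (_ : delta_mx 0 j = \row_k (k == j)%:R); last first.
  by apply/rowP => k; rewrite !mxE eqxx.
apply: is_derive_row => k; case: (k == j); first exact: is_derive_id.
exact: is_derive_cst.
Qed.

Lemma has_partial_drift j i t :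
  has_partial j (fun y => drift i (y, t)) (fun y => ddrift j i (y, t)).
Proof.
move=> x s.
pose c (r : R) := (upd x j r, \row_k dx k F (upd x j r, t)).
have dc : is_derive s 1 c
    (delta_mx 0 j, \row_k dx j (dx k F) (upd x j s, t)).
  apply: is_derive_pair; first exact: is_derive_upd.
  by apply: is_derive_row => k; exact: (has_partial_dx j t (smooth_dx k sF)).
have dg : differentiable (dp i) (c s) by apply: smooth_differentiable; exact: smooth_dp.
have := is_derive_comp_diff dg dc.
congr is_derive.
(* The velocity of the curve [c] is split into basis directions of phase space, on which the linear
   differential of [dp i] yields the terms of [ddrift]. *)
have -> : (delta_mx 0 j, \row_k dx j (dx k F) (upd x j s, t)) =
    (delta_mx 0 j, 0) + \sum_k dx j (dx k F) (upd x j s, t) *: (0, delta_mx 0 k)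
    :> V * V.
  set a := fun k => dx j (dx k F) (upd x j s, t).
  have -> : \sum_k a k *: (0, delta_mx 0 k) = (0, \sum_k a k *: delta_mx 0 k) :> V * V.
    elim/big_ind2: _ => // [x1 x2 y1 y2 -> ->|k _]; last first.
      by rewrite -[LHS]/(_, _) scaler0.
    by rewrite -[LHS]/(_, _) addr0.
  rewrite -[RHS]/(_, _) addr0 add0r; congr pair.
  by rewrite [LHS]row_sum_delta; apply: eq_bigr => k _; rewrite mxE.
rewrite deriveE// linearD linear_sum /ddrift; congr (_ + _); first by rewrite deriveE.
by apply: eq_bigr => k _; rewrite linearZ /= deriveE.
Qed.

Lemma DpH_drift (u : V -> R -> R) (t : R) x i : (forall y, F (y, t) = u y t) ->
  DpH H u x t 0 i = drift i (x, t).
Proof.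
move=> Fu; rewrite /DpH (_ : u ^~ t = fun y => F (y, t)); last first.
  by apply/funext => y; rewrite Fu.
rewrite gradE// mxE /drift /dp.
have E (h : R) : H x (h *: delta_mx 0 i + \row_k dx k F (x, t)) =
    (fun z : V * V => H z.1 z.2)
      (h *: (0, delta_mx 0 i) + (x, \row_k dx k F (x, t))).
  by rewrite /= scaler0 add0r.
by have [_ ->] := @derivative_reparam R V (V * V)%type (H x)
  (fun z : V * V => H z.1 z.2) (\row_k dx k F (x, t)) (delta_mx 0 i)
  (x, \row_k dx k F (x, t)) (0, delta_mx 0 i) E.
Qed.

Lemma zperiodic_drift i t : (forall q, zperiodic (H ^~ q)) ->
  zperiodic (fun y => F (y, t)) -> zperiodic (fun y => drift i (y, t)).
Proof.
move=> pH pF k x; rewrite /drift /=.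
have -> : \row_l dx l F (x + delta_mx 0 k, t) = \row_l dx l F (x, t).
  by apply/rowP => l; rewrite !mxE (zperiodic_partial (has_partial_dx l t sF) pF).
have E (q : V) (h : R) : (fun z : V * V => H z.1 z.2)
      (h *: (0, delta_mx 0 i) + (x + delta_mx 0 k, q)) =
    (fun z : V * V => H z.1 z.2) (h *: (0, delta_mx 0 i) + (x, q)).
  by rewrite /= scaler0 !add0r pH.
by rewrite /dp; have [_ ->] := @derivative_reparam R (V * V)%type (V * V)%type
  (fun z : V * V => H z.1 z.2) (fun z : V * V => H z.1 z.2)
  (x + delta_mx 0 k, \row_l dx l F (x, t)) (0, delta_mx 0 i)
  (x, \row_l dx l F (x, t)) (0, delta_mx 0 i) (E _).
Qed.

End drift.

(** * The test function and the energy dissipation inequality *)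

Section energy.
Context {R : realType} {n : nat}.
Local Notation V := 'rV[R]_n.

(** [bracket (be / 2)] grows like |s|^be and is the square of [bracket (be / 4)], the function
    giving w. *)
Definition bracket (a s : R) : R := (s ^+ 2 + 1) `^ a.

Lemma sqrD1_ge1 (s : R) : 1 <= s ^+ 2 + 1.
Proof. by rewrite lerDr sqr_ge0. Qed.

Lemma sqrD1_gt0 (s : R) : 0 < s ^+ 2 + 1.
Proof. exact: lt_le_trans ltr01 (sqrD1_ge1 s). Qed.

Lemma bracket_ge1 (a s : R) : 0 <= a -> 1 <= bracket a s.
Proof. by move=> a0; rewrite powR_ge1// sqrD1_ge1. Qed.

Lemma bracketS (a s : R) : bracket (a + 1) s = bracket a s * (s ^+ 2 + 1).
Proof.
rewrite /bracket powRD; last by apply/implyP => _; rewrite gt_eqF// sqrD1_gt0.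
by rewrite powRr1// ltW// sqrD1_gt0.
Qed.

Lemma is_derive_bracket (a s : R) :
  is_derive s 1 (bracket a) (2 * a * s * bracket (a - 1) s).
Proof.
have h1 : is_derive s 1 (fun y : R => y ^+ 2 + 1) (2 * s).
  have := is_deriveD (is_deriveX 2 (is_derive_id s 1)) (is_derive_cst (1 : R) s 1).
  by congr is_derive; rewrite addr0 /= expr1 -[_ *: _]/(_ * _) mulr1.
have h2 := is_derive1_powR a (sqrD1_gt0 s).
have := is_derive1_comp (f := fun y => y `^ a) (g := fun y : R => y ^+ 2 + 1).
move=> /(_ _ _ _ h2 h1); congr is_derive.
by rewrite /bracket; ring.
Qed.

Lemma continuous_bracket (T : topologicalType) a (f : T -> R) :
  continuous f -> continuous (fun x => bracket a (f x)).
Proof.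
move=> cf; apply: continuous_powR => [|x]; last exact: sqrD1_gt0.
by apply: continuous_addr; [exact: continuous_mulr|exact: continuous_constr].
Qed.

Definition dbracket (a s : R) : R := 2 * a * s * bracket (a - 1) s.
Definition d2bracket (a s : R) : R :=
  2 * a * bracket (a - 1) s + 2 * a * s * dbracket (a - 1) s.

Lemma is_derive_dbracket (a s : R) : is_derive s 1 (dbracket a) (d2bracket a s).
Proof.
have h1 : is_derive s 1 (fun y : R => 2 * a * y) (2 * a).
  have := is_deriveZ (2 * a) (is_derive_id s 1).
  by rewrite -[_ *: 1]/(_ * 1) mulr1.
have := is_deriveM h1 (is_derive_bracket (a - 1) s).
congr is_derive; rewrite /d2bracket /dbracket.
by rewrite -![_ *: _]/(_ * _); ring.
Qed.

Lemma continuous_dbracket (T : topologicalType) a (f : T -> R) :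
  continuous f -> continuous (fun x => dbracket a (f x)).
Proof.
move=> cf; apply: continuous_mulr; last exact: continuous_bracket.
by apply: continuous_mulr => //; exact: continuous_constr.
Qed.

Lemma continuous_d2bracket (T : topologicalType) a (f : T -> R) :
  continuous f -> continuous (fun x => d2bracket a (f x)).
Proof.
move=> cf; apply: continuous_addr.
  by apply: continuous_mulr; [exact: continuous_constr|exact: continuous_bracket].
apply: continuous_mulr; last exact: continuous_dbracket.
by apply: continuous_mulr => //; exact: continuous_constr.
Qed.

Lemma bracket_sqr (a s : R) : bracket a s ^+ 2 = bracket (2 * a) s.
Proof. by rewrite /bracket -powR_mulrn ?powR_ge0// -powRrM mulrC. Qed.

Lemma d2bracketE (be s : R) :
  d2bracket (be / 2) s = be * bracket (be / 2 - 2) s * (1 + (be - 1) * s ^+ 2).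
Proof.
rewrite /d2bracket /dbracket.
have -> : bracket (be / 2 - 1) s = bracket (be / 2 - 2) s * (s ^+ 2 + 1).
  by rewrite -bracketS; congr bracket; lra.
have -> : be / 2 - 1 - 1 = be / 2 - 2 by lra.
by field.
Qed.

Lemma d2bracket_ge0 (be s : R) : 1 < be -> 0 <= d2bracket (be / 2) s.
Proof.
move=> be1; rewrite d2bracketE !mulr_ge0 ?powR_ge0//; first by lra.
by rewrite addr_ge0// mulr_ge0 ?sqr_ge0//; lra.
Qed.

(** For pure powers s^be and s^(be/2) this is an equality, which is where 4 (be - 1)/be comes from;
    the summand 1 in [d2bracketE] is the slack. *)
Lemma dbracket_sqr_le (be s : R) : 1 < be ->
  4 * (be - 1) / be * dbracket (be / 4) s ^+ 2 <= d2bracket (be / 2) s.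
Proof.
move=> be1; rewrite d2bracketE /dbracket exprMn bracket_sqr.
have -> : 2 * (be / 4 - 1) = be / 2 - 2 by lra.
have P0 : 0 <= bracket (be / 2 - 2) s by exact: powR_ge0.
have -> : 4 * (be - 1) / be * ((2 * (be / 4) * s) ^+ 2 * bracket (be / 2 - 2) s) =
    be * bracket (be / 2 - 2) s * ((be - 1) * s ^+ 2).
  by field; lra.
rewrite ler_wpM2l// ?mulr_ge0//; first by lra.
by rewrite lerDr.
Qed.

(** Lets w^2 pay for the drift term. A pure power would give be (be - 1); be^2 also covers the
    lower-order terms. *)
Lemma d2bracket_le (be s : R) : 1 < be ->
  d2bracket (be / 2) s * s ^+ 2 <= be ^+ 2 * bracket (be / 4) s ^+ 2.
Proof.
move=> be1; rewrite d2bracketE bracket_sqr.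
have -> : 2 * (be / 4) = be / 2 - 2 + 1 + 1 by lra.
rewrite !bracketS.
have P0 : 0 <= bracket (be / 2 - 2) s by exact: powR_ge0.
have -> : be * bracket (be / 2 - 2) s * (1 + (be - 1) * s ^+ 2) * s ^+ 2 =
  bracket (be / 2 - 2) s * (be * ((1 + (be - 1) * s ^+ 2) * s ^+ 2)) by ring.
rewrite -[in leRHS]mulrA [in leRHS]mulrCA ler_wpM2l//.
have s0 : 0 <= s ^+ 2 by exact: sqr_ge0.
rewrite expr2 -mulrA ler_wpM2l//; first by lra.
move: (s ^+ 2) s0 => y y0.
have : 0 <= (be - 1) * y by rewrite mulr_ge0//; lra.
nra.
Qed.

(** With [s] the density, [y] its partial derivative and [z] the drift component, (y + s z)^2 >= 0
    gives -y (y + s z) <= (s^2 z^2 - y^2)/2; hence half of be^2 and half of 4 (be - 1)/be. *)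
Lemma dissipation_algebra (be ph dw w2 y z s : R) : 1 < be -> 0 <= ph ->
  ph * s ^+ 2 <= be ^+ 2 * w2 -> 4 * (be - 1) / be * dw <= ph ->
  -1 * (ph * y * (y + s * z)) <=
  be ^+ 2 / 2 * (w2 * z ^+ 2) - 2 * (be - 1) / be * (dw * y ^+ 2).
Proof.
move=> be1 ph0 H1 H2.
have H3 : ph * s ^+ 2 * z ^+ 2 <= be ^+ 2 * w2 * z ^+ 2 by rewrite ler_wpM2r ?sqr_ge0.
have H4 : 4 * (be - 1) / be * dw * y ^+ 2 <= ph * y ^+ 2 by rewrite ler_wpM2r ?sqr_ge0.
have H5 : 0 <= ph * (y + s * z) ^+ 2 by rewrite mulr_ge0 ?sqr_ge0.
have -> : 2 * (be - 1) / be * (dw * y ^+ 2) = (4 * (be - 1) / be * dw * y ^+ 2) / 2.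
  by field; lra.
move: H3 H4 H5; move: (_ / be * dw * y ^+ 2) => A H3 H4 H5.
nra.
Qed.

Lemma energy_dissipation (be : R) (m mt : V -> R)
    (dm d2m b db : 'I_n -> V -> R) :
  1 < be ->
  continuous m -> (forall i, continuous (dm i)) -> (forall i, continuous (d2m i)) ->
  (forall i, continuous (b i)) -> (forall i, continuous (db i)) ->
  (forall i, has_partial i m (dm i)) -> (forall i, has_partial i (dm i) (d2m i)) ->
  (forall i, has_partial i (b i) (db i)) ->
  zperiodic m -> (forall i, zperiodic (b i)) ->
  (forall x, mt x = \sum_i d2m i x + \sum_i (m x * db i x + b i x * dm i x)) ->
  tint (fun x => dbracket (be / 2) (m x) * mt x) <=
  be ^+ 2 / 2 * tint (fun x => bracket (be / 4) (m x) ^+ 2 * \sum_i b i x ^+ 2) -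
  2 * (be - 1) / be * grad2 (fun i x => dbracket (be / 4) (m x) * dm i x).
Proof.
move=> be1 cm cdm cd2m cb cdb hm hdm hb pm pb mtE.
(* The flux: the equation reads m_t = div J, so one integration by parts treats diffusion and drift
   together. *)
pose J i x := dm i x + m x * b i x.
pose DJ i x := d2m i x + (m x * db i x + b i x * dm i x).
have hJ i : has_partial i (J i) (DJ i).
  by apply: has_partialD => //; exact: has_partialM.
have cJ i : continuous (J i) by apply: continuous_addr => //; exact: continuous_mulr.
have cDJ i : continuous (DJ i).
  by apply: continuous_addr => //; apply: continuous_addr; exact: continuous_mulr.
have pJ i : zperiodic (J i).
  by move=> k x; rewrite /J (zperiodic_partial (hm i) pm) pm pb.
have cph := continuous_dbracket (a := be / 2) cm.
have cd2 := continuous_d2bracket (a := be / 2) cm.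
have hph i := has_partial_comp (is_derive_dbracket (be / 2)) (hm i).
have pph : zperiodic (fun x => dbracket (be / 2) (m x)) by move=> k x; rewrite pm.
have cdd i : continuous (fun x => d2bracket (be / 2) (m x) * dm i x) by exact: continuous_mulr.
have -> : (fun x => dbracket (be / 2) (m x) * mt x) =
    (fun x => \sum_i dbracket (be / 2) (m x) * DJ i x).
  by apply/funext => x; rewrite mtE -big_split/= mulr_sumr.
rewrite tint_sum; last by move=> i; exact: continuous_mulr.
have cw2 : continuous (fun x => bracket (be / 4) (m x) ^+ 2).
  by apply: continuous_mulr; exact: continuous_bracket.
have cdw i : continuous (fun x => dbracket (be / 4) (m x) * dm i x).
  by apply: continuous_mulr => //; exact: continuous_dbracket.
rewrite /grad2 mulr_sumr.
have -> : (fun x => bracket (be / 4) (m x) ^+ 2 * \sum_i b i x ^+ 2) =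
   (fun x => \sum_i bracket (be / 4) (m x) ^+ 2 * b i x ^+ 2).
  by apply/funext => x; rewrite mulr_sumr.
have cwb i : continuous (fun x => bracket (be / 4) (m x) ^+ 2 * b i x ^+ 2).
  by apply: continuous_mulr => //; exact: continuous_mulr.
rewrite tint_sum// mulr_sumr -sumrB; apply: ler_sum => i _.
rewrite (tint_by_parts (hph i) (hJ i))//.
have cdw2 : continuous (fun x => (dbracket (be / 4) (m x) * dm i x) ^+ 2).
  exact: continuous_mulr.
have cdJ : continuous (fun x => d2bracket (be / 2) (m x) * dm i x * J i x).
  exact: continuous_mulr.
rewrite -(tintZ (be ^+ 2 / 2) (cwb i)) -(tintZ (2 * (be - 1) / be) cdw2).
rewrite -[leLHS]mulN1r -(tintZ (- 1) cdJ).
rewrite -tintB; last 2 first.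
- by apply: continuous_mulr => //; exact: continuous_constr.
- by apply: continuous_mulr => //; exact: continuous_constr.
apply: le_tint.
- by apply: continuous_mulr; [exact: continuous_constr|exact: continuous_mulr].
- by apply: continuous_subr; apply: continuous_mulr => //; exact: continuous_constr.
move=> x; rewrite /J.
have := dbracket_sqr_le (m x) be1; have := d2bracket_le (m x) be1.
have := d2bracket_ge0 (m x) be1.
rewrite (exprMn 2 (dbracket (be / 4) (m x)) (dm i x)).
exact: dissipation_algebra.
Qed.

End energy.

Section growth.
Context {R : realType}.

(** |DpH|^2 and its norms may vanish, where the power need not be differentiable; at a zero of [f],
    f y < e^(1/a) gives f y ^ a < e. *)
Lemma continuous_powR_ge0 (T : topologicalType) (f : T -> R) (a : R) : 0 < a ->
  continuous f -> (forall x, 0 <= f x) -> continuous (fun x => f x `^ a).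
Proof.
move=> a0 cf f0 x; have [fx0|fx0] := ltP 0 (f x).
  suff H : {for f x, continuous (fun y : R => y `^ a)}.
    exact: (cvg_comp _ _ (cf x) H).
  apply: differentiable_continuous; apply/derivable1_diffP.
  by apply: derivable_powR; rewrite in_itv /= fx0.
have {}fx0 : f x = 0 by apply/eqP; rewrite eq_le fx0 f0.
rewrite /continuous_at fx0 powR0 ?gt_eqF//.
apply/cvgrPdist_lt => e e0.
have e0' : 0 < e `^ a^-1 by rewrite powR_gt0.
have /cvgrPdist_lt/(_ _ e0') := cf x; apply: filterS => y.
rewrite fx0 !sub0r !normrN (ger0_norm (f0 _)) (ger0_norm (powR_ge0 _ _)) => fy.
have -> : e = (e `^ a^-1) `^ a.
  by rewrite -powRrM mulVf ?gt_eqF// powRr1// ltW.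
by rewrite gt0_ltr_powR// nnegrE// ltW.
Qed.

Context {n : nat}.
Implicit Types f g : 'rV[R]_n -> R.

Lemma Lnorm_tint f (p : R) : 0 < p -> continuous f ->
  Lnorm (torus_measure n) p%:E (fun x => (f (vec x))%:E) =
  (tint (fun x => `|f x| `^ p) `^ p^-1)%:E.
Proof.
move=> p0 cf.
have cfp : continuous (fun x => `|f x| `^ p).
  by apply: continuous_powR_ge0 => //; exact: continuous_normr.
by rewrite unlock -poweR_EFin (tintE cfp).
Qed.

(** |DpH|^2 has no positive lower bound, so [generalized_hoelder] does not apply to it; this version
    comes from the inequality for Lebesgue norms. *)
Lemma tint_hoelder f g (p q : R) : 0 < p -> 0 < q -> p^-1 + q^-1 = 1 ->
  continuous f -> continuous g -> (forall x, 0 <= f x) -> (forall x, 0 <= g x) ->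
  tint (fun x => f x * g x) <=
  tint (fun x => f x `^ p) `^ p^-1 * tint (fun x => g x `^ q) `^ q^-1.
Proof.
move=> p0 q0 pq cf cg f0 g0.
have := @hoelder _ _ _ (torus_measure n) (fun x => f (vec x)) (fun x => g (vec x)) p q
  (continuous_measurable_vec cf) (continuous_measurable_vec cg) p0 q0 pq.
have E (h : 'rV[R]_n -> R) a : (forall x, 0 <= h x) ->
    (fun x => `|h x| `^ a) = (fun x => h x `^ a).
  by move=> h0; apply/funext => x; rewrite ger0_norm.
have cfg : continuous (fun x => f x * g x) by exact: continuous_mulr.
have -> : 'N[torus_measure n]_1[EFin \o ((fun x => f (vec x)) \* (fun x => g (vec x)))%R]%E =
    (tint (fun x => f x * g x))%:E.
  rewrite Lnorm1 (tintE cfg); apply: eq_integral => x _ /=.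
  by rewrite ger0_norm// mulr_ge0.
rewrite (Lnorm_tint p0 cf) (Lnorm_tint q0 cg) -EFinM lee_fin.
by rewrite (E _ _ f0) (E _ _ g0).
Qed.

Lemma bracket_C1_ge1 (a : R) (m : 'rV[R]_n -> R) dm : 0 <= a -> continuous m ->
  (forall i, continuous (dm i)) -> (forall i, has_partial i m (dm i)) -> zperiodic m ->
  C1_ge1 (fun x => bracket a (m x)) (fun i x => dbracket a (m x) * dm i x).
Proof.
move=> a0 cm cdm hm pm; split.
- exact: continuous_bracket.
- by move=> i; apply: continuous_mulr => //; exact: continuous_dbracket.
- by move=> x; exact: bracket_ge1.
- by move=> i x; rewrite pm.
- by move=> i; exact: (has_partial_comp (is_derive_bracket a) (hm i)).
Qed.

Lemma growth_algebra (c0 c1 x y K z v : R) : 0 < c1 ->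
  x <= c0 / c1 * y + K * z * v -> c1 * x - c0 * y <= c1 * K * z * v.
Proof.
move=> c10 /(ler_wpM2l (ltW c10)).
have -> : c1 * (c0 / c1 * y + K * z * v) = c0 * y + c1 * K * z * v.
  by field; rewrite gt_eqF.
lra.
Qed.

Lemma bracket_growth (be theta p q : R) : (2 < n)%N ->
  n%:R / 2 < p -> p^-1 + q^-1 = 1 -> 1 < theta -> 1 <= be ->
  exists2 K : R, 0 <= K &
    forall (m mt : 'rV[R]_n -> R) (dm d2m b db : 'I_n -> 'rV[R]_n -> R),
    continuous m -> (forall i, continuous (dm i)) -> (forall i, continuous (d2m i)) ->
    (forall i, continuous (b i)) -> (forall i, continuous (db i)) ->
    (forall i, has_partial i m (dm i)) -> (forall i, has_partial i (dm i) (d2m i)) ->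
    (forall i, has_partial i (b i) (db i)) ->
    zperiodic m -> (forall i, zperiodic (b i)) ->
    (forall x, mt x = \sum_i d2m i x + \sum_i (m x * db i x + b i x * dm i x)) ->
    tint (fun x => dbracket (theta * be / 2) (m x) * mt x) <=
    K * (1 + (tint (fun x => (\sum_i b i x ^+ 2) `^ p) `^ p^-1)
               `^ (gn_exponent n%:R q theta)^-1) *
      tint (fun x => bracket (be / 2) (m x)) `^ theta.
Proof.
move=> n2 np pq t1 be1.
have N2 : 2 < n%:R :> R by rewrite ltr_nat.
have [p0 q1 qn] := conjugate_exponent_bounds N2 np pq.
have q0 : 0 < q by exact: lt_le_trans ltr01 q1.
have [be2 be2E] : {x | x = theta * be} by eexists.
have theta0 : theta != 0 by rewrite gt_eqF// (lt_trans ltr01).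
(* With be2 = theta be the next exponent, w^(2/theta) is [bracket (be / 2)] of m, the integrand
   controlled at the previous step. *)
have be2K : be2 / 4 * (2 / theta) = be / 2 by rewrite be2E; field.
have be21 : 1 < be2 by rewrite be2E; nra.
have be40 : 0 <= be2 / 4 by rewrite divr_ge0// ltW// (lt_trans ltr01).
pose c0 := 2 * (be2 - 1) / be2; pose c1 := be2 ^+ 2 / 2.
have c00 : 0 < c0 by rewrite divr_gt0// ?mulr_gt0// ?subr_gt0// (lt_trans ltr01).
have c10 : 0 < c1 by rewrite divr_gt0// exprn_gt0// (lt_trans ltr01).
rewrite -be2E.
(* The parameter c0/c1 makes the gradient term, after multiplication by c1, cancel the dissipation
   exactly. *)
have [K K0 HK] := gagliardo_nirenberg_young n2 t1 q1 qn (divr_gt0 c00 c10).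
exists (c1 * K); first by rewrite mulr_ge0// ltW.
move=> m mt dm d2m b db cm cdm cd2m cb cdb hm hdm hb pm pb mtE.
apply: (le_trans (energy_dissipation be21 cm cdm cd2m cb cdb hm hdm hb pm pb mtE)).
have Cw := bracket_C1_ge1 be40 cm cdm hm pm.
pose b2 x := \sum_i b i x ^+ 2.
have cb2 : continuous b2 by apply: continuous_bigsum => i _; exact: continuous_mulr.
have b20 x : 0 <= b2 x by apply: sumr_ge0 => i _; exact: sqr_ge0.
rewrite -/b2; have [B BE] : {y | y = tint (fun x => b2 x `^ p) `^ p^-1} by eexists.
rewrite -BE; have B0 : 0 <= B by rewrite BE powR_ge0.
have {}HK := HK _ _ B Cw B0.
have cbr : continuous (fun x => bracket (be2 / 4) (m x)) by exact: continuous_bracket.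
have cbr2 : continuous (fun x => bracket (be2 / 4) (m x) ^+ 2) by exact: continuous_mulr.
have Hh := tint_hoelder p0 q0 pq cb2 cbr2 b20 (fun x => sqr_ge0 _).
rewrite -BE in Hh.
have E1 : (fun x => (bracket (be2 / 4) (m x) ^+ 2) `^ q) =
    (fun x => bracket (be2 / 4) (m x) `^ (2 * q)).
  by apply/funext => x; rewrite powRrM -powR_mulrn// powR_ge0.
have E2 : (fun x => bracket (be2 / 4) (m x) `^ (2 / theta)) =
    (fun x => bracket (be / 2) (m x)).
  by apply/funext => x; rewrite /bracket -powRrM be2K.
rewrite E1 in Hh; rewrite E2 in HK.
have -> : (fun x => bracket (be2 / 4) (m x) ^+ 2 * \sum_i b i x ^+ 2) =
    (fun x => b2 x * bracket (be2 / 4) (m x) ^+ 2).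
  by apply/funext => x; rewrite mulrC.
exact: (growth_algebra c10 (le_trans Hh HK)).
Qed.

End growth.

(** * Iteration in time *)

Section evolution.
Context {R : realType} {n : nat}.
Local Notation V := 'rV[R]_n.

Lemma lebesgue_itvE (a b : R) (A : set (measurableTypeR R)) :
  lebesgue_itv a b A = lebesgue_measure (A `&` `[a, b]).
Proof. by []. Qed.

Lemma ae_lebesgue_itv_mem (a b : R) :
  {ae (lebesgue_itv a b), forall x : measurableTypeR R, a <= x <= b}.
Proof.
exists (~` `[a, b]%classic); split; first by apply: measurableC; exact: measurable_itv.
  by rewrite lebesgue_itvE setICl measure0.
by move=> x /= H; rewrite in_itv.
Qed.

Lemma ae_lebesgue_itv_neq (a b c : R) :
  {ae (lebesgue_itv a b), forall x : measurableTypeR R, x != c}.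
Proof.
exists [set c]; split => //.
  rewrite lebesgue_itvE; apply/eqP; rewrite -measure_le0.
  rewrite -(lebesgue_measure_set1 c) le_measure ?inE//.
  by apply: measurableI => //; exact: measurable_itv.
by move=> x /= /negP; rewrite negbK => /eqP.
Qed.

Lemma ae_lebesgue_itvS (a b c : R) (P : measurableTypeR R -> Prop) : c <= b ->
  {ae (lebesgue_itv a b), forall x : measurableTypeR R, P x} ->
  {ae (lebesgue_itv a c), forall x : measurableTypeR R, P x}.
Proof.
move=> cb [N [mN N0 PN]]; exists N; split => //.
rewrite lebesgue_itvE; apply/eqP; rewrite -measure_le0 -[leRHS]N0 lebesgue_itvE.
rewrite le_measure ?inE//.
- by apply: measurableI => //; exact: measurable_itv.
- by apply: measurableI => //; exact: measurable_itv.
- apply: setIS => x /=; rewrite !in_itv /= => /andP[-> xc].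
  exact: le_trans cb.
Qed.

Lemma le_pint_ae a b (f g : R -> R) : continuous f -> continuous g ->
  {ae (lebesgue_itv a b), forall x : measurableTypeR R, f x <= g x} ->
  pint a b f <= pint a b g.
Proof.
move=> cf cg fg; have cm := continuous_maxr cf cg.
apply: (@le_trans _ _ (pint a b (fun x => Num.max (f x) (g x)))).
  by apply: le_pint => // x _; rewrite le_max lexx.
have mE (h : R -> R) : continuous h -> measurable_fun setT (EFin \o h).
  by move=> ch; apply/measurable_EFinP; exact: continuous_measurable_fun.
rewrite -lee_fin !pintE// -!integral_lebesgue_itv; [|exact: mE|exact: mE].
rewrite le_eqVlt; apply/orP; left; apply/eqP.
apply: ae_eq_integral => //; [exact: mE|exact: mE|].
by apply: filterS fg => x fg _; rewrite max_r.
Qed.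

Context (T : R) (H : V -> V -> R) (u0 m0 : V -> R) (geps : (V -> R) -> V -> R)
  (u m : V -> R -> R) (Fu Fm : V * R -> R).
Context (T0 : 0 < T) (hH : hamiltonian H) (sol : mfg_solution T H u0 m0 geps u m)
  (sFu : smooth Fu) (sFm : smooth Fm)
  (Fu_u : forall x t, 0 <= t <= T -> Fu (x, t) = u x t)
  (Fm_m : forall x t, 0 <= t <= T -> Fm (x, t) = m x t).

Let sH := hamiltonian_smooth hH.

Lemma zperiodic_Fm t : 0 <= t <= T -> zperiodic (fun x => Fm (x, t)).
Proof. by move=> t0T k x; rewrite !Fm_m//; have [_] := mfg_periodic sol t0T; exact. Qed.

Lemma zperiodic_Fu t : 0 <= t <= T -> zperiodic (fun x => Fu (x, t)).
Proof. by move=> t0T k x; rewrite !Fu_u//; have [+ _] := mfg_periodic sol t0T; exact. Qed.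

Lemma fokker_planckE x t : 0 < t < T ->
  dt Fm (x, t) = \sum_i dx i (dx i Fm) (x, t) +
    \sum_i (Fm (x, t) * ddrift H Fu i i (x, t) + drift H Fu i (x, t) * dx i Fm (x, t)).
Proof.
move=> t0T; have t0T' : 0 <= t <= T by case/andP: t0T => *; rewrite !ltW.
have := mfg_fokker_planck sol x t0T.
have -> : m ^~ t = (fun y => Fm (y, t)) by apply/funext => y; rewrite Fm_m.
rewrite laplacianE// => <-.
have -> : derive1 (m x) t = dt Fm (x, t).
  rewrite derive1E; have [_ <-] := is_derive_dt x t sFm.
  (* [m x] and its extension agree on a neighbourhood of [t] because [t] is interior. *)
  apply: near_eq_derive.
  have : \forall s \near t, 0 < s < T.
    by apply: (near_in_itvoo (a := 0) (b := T)); rewrite in_itv.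
  by apply: filterS => s /andP[s0 sT]; rewrite Fm_m// !ltW.
rewrite /divergence.
have -> : \sum_i 'D_(delta_mx 0 i) (fun y => (m y t *: DpH H u y t) 0 i) x =
    \sum_i (Fm (x, t) * ddrift H Fu i i (x, t) + drift H Fu i (x, t) * dx i Fm (x, t)).
  apply: eq_bigr => i _.
  rewrite -(has_partialE x (has_partialM (has_partial_dx i t sFm)
    (has_partial_drift sH sFu i i t))).
  apply: (congr1 (fun g => 'D_(delta_mx 0 i) g x)); apply/funext => y.
  by rewrite mxE Fm_m// (@DpH_drift _ _ H _ sFu)// => z; rewrite Fu_u.
by rewrite subrK.
Qed.

Definition drift_norm (p : R) (t : R) : R :=
  tint (fun x => (\sum_i drift H Fu i (x, t) ^+ 2) `^ p) `^ p^-1.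

Lemma continuous_drift_norm (p : R) : 0 < p -> continuous (drift_norm p).
Proof.
move=> p0.
have cs : continuous (fun z : R * V => (\sum_i drift H Fu i (z.2, z.1) ^+ 2) `^ p).
  apply: continuous_powR_ge0 => // [|z]; last by apply: sumr_ge0 => i _; exact: sqr_ge0.
  apply: continuous_bigsum => i _.
  have := continuous_swap (continuous_drift (i := i) sH sFu).
  by move=> cd; exact: continuous_mulr.
apply: continuous_powR_ge0; first by rewrite invr_gt0.
  exact: (continuous_tint cs).
by move=> t; apply: tint_ge0 => x; exact: powR_ge0.
Qed.

(** The fundamental theorem of calculus at each fixed [x], then Fubini; no differentiation under the
    integral is involved. *)
Lemma bracket_evolution (a tau : R) : 0 <= tau <= T ->
  tint (fun x => bracket a (m x tau)) - tint (fun x => bracket a (m0 x)) =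
  pint 0 tau (fun t => tint (fun x => dbracket a (Fm (x, t)) * dt Fm (x, t))).
Proof.
move=> /andP[tau0 tauT].
have cFm := smooth_continuous sFm.
have ch : continuous (fun z => dbracket a (Fm z) * dt Fm z).
  apply: continuous_mulr; first exact: continuous_dbracket.
  exact: continuous_derive.
rewrite -(tint_pint tau0 ch).
have -> : (fun x => bracket a (m x tau)) = (fun x => bracket a (Fm (x, tau))).
  by apply/funext => x; rewrite Fm_m// tau0.
have -> : (fun x => bracket a (m0 x)) = (fun x => bracket a (Fm (x, 0))).
  by apply/funext => x; rewrite Fm_m ?lexx ?ltW// (mfg_initial sol).
rewrite -tintB; last 2 first.
- by apply: continuous_bracket; exact: continuous_pair2 cFm.
- by apply: continuous_bracket; exact: continuous_pair2 cFm.
apply: congr1; apply/funext => x.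
have cx : continuous (fun t => dbracket a (Fm (x, t)) * dt Fm (x, t)).
  exact: (continuous_pair1 (x := x) ch).
have hx t : is_derive (t : R) 1 (fun t => bracket a (Fm (x, t)))
    (dbracket a (Fm (x, t)) * dt Fm (x, t)).
  exact: (is_derive1_comp (f := bracket a) (g := fun t => Fm (x, t))
    (is_derive_bracket a _) (is_derive_dt x t sFm)).
by rewrite (pint_FTC tau0 cx hx).
Qed.

End evolution.

Section iteration_step.
Context {R : realType} {n : nat}.
Local Notation V := 'rV[R]_n.

(** Asking for the bound [y] only at almost every time fits both the initial hypothesis and the
    bounds produced by earlier steps. *)
Lemma bracket_step (be theta p q : R) : (2 < n)%N ->
  n%:R / 2 < p -> p^-1 + q^-1 = 1 -> 1 < theta -> 1 <= be ->
  exists2 K : R, 0 <= K &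
    forall (T : R) (H : V -> V -> R) (u0 m0 : V -> R) (geps : (V -> R) -> V -> R)
      (u m : V -> R -> R) (Fu Fm : V * R -> R) (y : R),
    0 < T -> hamiltonian H -> mfg_solution T H u0 m0 geps u m ->
    smooth Fu -> smooth Fm ->
    (forall x t, 0 <= t <= T -> Fu (x, t) = u x t) ->
    (forall x t, 0 <= t <= T -> Fm (x, t) = m x t) ->
    {ae (lebesgue_itv 0 T), forall t : measurableTypeR R,
      tint (fun x => bracket (be / 2) (m x t)) <= y} ->
    forall tau, 0 <= tau <= T ->
    tint (fun x => bracket (theta * be / 2) (m x tau)) <=
    tint (fun x => bracket (theta * be / 2) (m0 x)) +
    K * y `^ theta *
      (T + pint 0 T (fun t => drift_norm H Fu p t `^ (gn_exponent n%:R q theta)^-1)).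
Proof.
move=> n2 np pq t1 be1.
have [K K0 HK] := bracket_growth n2 np pq t1 be1.
exists K => // T H u0 m0 geps u m Fu Fm y T0 hH sol sFu sFm Fu_u Fm_m hy tau tauT.
have sH := hamiltonian_smooth hH.
have /andP[tau0 tau_T] := tauT.
rewrite addrC -lerBlDr (bracket_evolution T0 sol sFm Fm_m _ tauT).
set r := (gn_exponent _ _ _)^-1.
have N2 : 2 < n%:R :> R by rewrite ltr_nat.
have [p0 _ _] := conjugate_exponent_bounds N2 np pq.
have r0 : 0 < r by rewrite invr_gt0; exact: gn_exponent_gt0 np pq t1.
have cB : continuous (fun t => drift_norm H Fu p t `^ r).
  apply: continuous_powR_ge0 => // [|t]; last exact: powR_ge0.
  exact: (continuous_drift_norm hH sFu).
have cFm := smooth_continuous sFm.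
have ch : continuous (fun z => dbracket (theta * be / 2) (Fm z) * dt Fm z).
  by apply: continuous_mulr; [exact: continuous_dbracket|exact: continuous_derive].
have yt0 : 0 <= y `^ theta by exact: powR_ge0.
have c1B : continuous (fun t => 1 + drift_norm H Fu p t `^ r).
  by apply: continuous_addr => //; exact: continuous_constr.
apply: (@le_trans _ _ (pint 0 tau (fun t => K * y `^ theta * (1 + drift_norm H Fu p t `^ r)))).
  apply: le_pint_ae.
  - exact: (continuous_tint (continuous_swap ch)).
  - by apply: continuous_mulr => //; exact: continuous_constr.
  (* Discarding 0 and T leaves interior times, where the equation holds; [hy] discards a further
     null set. *)
  have h1 := ae_lebesgue_itv_mem 0 tau.
  have h2 := ae_lebesgue_itv_neq 0 tau 0.
  have h3 := ae_lebesgue_itv_neq 0 tau T.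
  have h4 := ae_lebesgue_itvS tau_T hy.
  apply: filterS2 (filterI h1 h2) (filterI h3 h4) => t [/andP[t0 ttau] tN0] [tNT ty].
  have t0T : 0 < t < T.
    by rewrite lt_neqAle eq_sym tN0 t0 lt_neqAle tNT (le_trans ttau).
  have t0T' : 0 <= t <= T by case/andP: t0T => *; rewrite !ltW.
  have := HK (fun x => Fm (x, t)) (fun x => dt Fm (x, t)) (fun i x => dx i Fm (x, t))
    (fun i x => dx i (dx i Fm) (x, t)) (fun i x => drift H Fu i (x, t))
    (fun i x => ddrift H Fu i i (x, t)).
  move=> /(_ _ _ _ _ _ _ _ _ _ _ _)/le_trans; apply.
  - exact: continuous_pair2 cFm.
  - by move=> i; apply: (continuous_pair2 (s := t)); exact: continuous_derive.
  - move=> i; apply: (continuous_pair2 (s := t)); apply: continuous_derive.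
    exact: smooth_dx.
  - by move=> i; apply: (continuous_pair2 (s := t)); exact: continuous_drift.
  - by move=> i; apply: (continuous_pair2 (s := t)); exact: continuous_ddrift.
  - by move=> i; exact: has_partial_dx.
  - by move=> i; apply: has_partial_dx; exact: smooth_dx.
  - by move=> i; exact: has_partial_drift.
  - exact: (zperiodic_Fm sol Fm_m).
  - by move=> i; apply: zperiodic_drift => //; [exact: hamiltonian_periodic hH|
      exact: (zperiodic_Fu sol Fu_u)].
  - by move=> x; exact: (fokker_planckE hH sol sFu sFm Fu_u Fm_m).
  rewrite -/(drift_norm H Fu p t) -/r (mulrAC K (y `^ theta)) ler_wpM2l//.
    by rewrite mulr_ge0// addr_ge0// powR_ge0.
  have -> : (fun x => bracket (be / 2) (Fm (x, t))) = (fun x => bracket (be / 2) (m x t)).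
    by apply/funext => x; rewrite Fm_m.
  apply: ge0_ler_powR => //; rewrite ?nnegrE; first by rewrite ltW// (lt_trans ltr01).
    by apply: tint_ge0 => x; exact: powR_ge0.
  by apply: (le_trans _ ty); apply: tint_ge0 => x; exact: powR_ge0.
rewrite pintZ// ler_wpM2l ?mulr_ge0// pintD//; last exact: continuous_constr.
rewrite pint_cst// mul1r subr0 lerD//.
apply: le_pint_subset => // t; exact: powR_ge0.
Qed.

End iteration_step.

Section iteration.
Context {R : realType} {n : nat}.
Local Notation V := 'rV[R]_n.

(* In the notation of the theorem, [r_n = r * geom theta n]. *)
Definition geom (theta : R) (k : nat) : R := (theta ^+ k - 1) / (theta - 1).

Lemma geom_ge0 (theta : R) k : 1 < theta -> 0 <= geom theta k.
Proof.
by move=> t1; rewrite divr_ge0// subr_ge0 ?exprn_ege1// ltW.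
Qed.

Lemma geomS (theta : R) k : 1 < theta -> geom theta k.+1 = 1 + theta * geom theta k.
Proof. by move=> t1; rewrite /geom exprS; field; rewrite subr_eq0 gt_eqF. Qed.

(** For rho <= 1 the two factors are at most 2^theta and T + 1. For rho > 1 the summands 1 and T are
    absorbed into powers of rho, and the exponents add up to theta s + 1. *)
Lemma step_algebra (theta s rho T : R) : 1 < theta -> 0 <= s -> 0 <= rho -> 0 < T ->
  (1 + rho `^ s) `^ theta * (T + rho) <=
  2 `^ theta * (T + 1) * (1 + rho `^ (1 + theta * s)).
Proof.
move=> t1 s0 rho0 T0; have t0 : 0 < theta by exact: lt_trans t1.
have p0 a : 0 <= rho `^ a by exact: powR_ge0.
have T10 : 0 <= T + 1 by rewrite addr_ge0// ltW.
have Tr0 : 0 <= T + rho by rewrite addr_ge0// ltW.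
have sr0 : 0 <= 1 + rho `^ s by rewrite addr_ge0.
have t20 : 0 <= 2 `^ theta * (T + 1) by rewrite mulr_ge0// powR_ge0.
have [rho1|rho1] := leP rho 1.
  apply: (@le_trans _ _ (2 `^ theta * (T + 1))).
    rewrite ler_pM ?powR_ge0//; last by rewrite lerD2l.
    rewrite ge0_ler_powR ?nnegrE ?(ltW t0)//.
    have : rho `^ s <= 1 `^ s by rewrite ge0_ler_powR ?nnegrE.
    by rewrite powR1; lra.
  by rewrite ler_peMr// lerDl.
have rho0' : 0 < rho by exact: lt_trans rho1.
apply: (@le_trans _ _ ((2 * rho `^ s) `^ theta * ((T + 1) * rho))).
  rewrite ler_pM ?powR_ge0//.
    rewrite ge0_ler_powR ?nnegrE ?(ltW t0) ?mulr_ge0//.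
    by rewrite mulr_natl mulr2n lerD2r powR_ge1// ltW.
  by rewrite mulrDl mul1r lerD2r ler_peMr// ltW.
rewrite powRM// -powRrM mulrACA ler_wpM2l//.
have -> : rho `^ (s * theta) * rho = rho `^ (1 + theta * s).
  rewrite powRD ?powRr1 ?(ltW rho0')// 1?mulrC 1?(mulrC s)//.
  by apply/implyP => _; rewrite gt_eqF.
by rewrite lerDr.
Qed.

(** Starts at exponent k + 1: level 0 is the hypothesis, known at almost every time, whereas all
    later levels hold at every time. *)
Lemma bracket_iterate (T p q theta be0 y0 : R) (m0 : V -> R) (k : nat) :
  (2 < n)%N -> 0 < T -> n%:R / 2 < p -> p^-1 + q^-1 = 1 -> 1 < theta -> 1 <= be0 ->
  exists2 C : R, 0 <= C &
    forall (H : V -> V -> R) (u0 : V -> R) (geps : (V -> R) -> V -> R)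
      (u m : V -> R -> R) (Fu Fm : V * R -> R),
    hamiltonian H -> mfg_solution T H u0 m0 geps u m ->
    smooth Fu -> smooth Fm ->
    (forall x t, 0 <= t <= T -> Fu (x, t) = u x t) ->
    (forall x t, 0 <= t <= T -> Fm (x, t) = m x t) ->
    {ae (lebesgue_itv 0 T), forall t : measurableTypeR R,
      tint (fun x => bracket (be0 / 2) (m x t)) <= y0} ->
    forall tau, 0 <= tau <= T ->
    tint (fun x => bracket (theta ^+ k.+1 * be0 / 2) (m x tau)) <=
    C * (1 + pint 0 T (fun t => drift_norm H Fu p t `^ (gn_exponent n%:R q theta)^-1)
               `^ geom theta k.+1).
Proof.
move=> n2 T0 np pq t1 be01.
have t0 : 0 < theta by exact: lt_trans t1.
have be1 j : 1 <= theta ^+ j * be0.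
  by rewrite -[1]mulr1 ler_pM// exprn_ege1// ltW.
have rho0 (H : V -> V -> R) Fu : 0 <= pint 0 T (fun t : R =>
    drift_norm H Fu p t `^ (gn_exponent n%:R q theta)^-1).
  by apply: Rintegral_ge0 => t _; exact: powR_ge0.
have X0 a : 0 <= tint (fun x => bracket a (m0 x)).
  by apply: tint_ge0 => x; exact: powR_ge0.
elim: k => [|k [C C0 IH]].
  have [K K0 HK] := bracket_step n2 np pq t1 be01.
  have y00 : 0 <= y0 `^ theta by exact: powR_ge0.
  exists (tint (fun x => bracket (theta * be0 / 2) (m0 x)) + K * y0 `^ theta * (T + 1)).
    by rewrite addr_ge0// !mulr_ge0// addr_ge0// ltW.
  move=> H u0 geps u m Fu Fm hH sol sFu sFm FuE FmE hy tau tauT.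
  have := HK T H u0 m0 geps u m Fu Fm y0 T0 hH sol sFu sFm FuE FmE hy tau tauT.
  rewrite expr1 => /le_trans; apply.
  move: (pint _ _ _) (rho0 H Fu) => rho r0.
  rewrite geomS// /geom expr0 subrr mul0r mulr0 addr0 powRr1//.
  rewrite mulrDl lerD//; first by rewrite ler_peMr// lerDl.
  rewrite -[leRHS]mulrA ler_wpM2l ?mulr_ge0// mulrDr mulr1 mulrDl mul1r.
  by rewrite -addrA lerD2l addrA lerDr addr_ge0// mulr_ge0// ltW.
have [K K0 HK] := bracket_step n2 np pq t1 (be1 k.+1).
have C10 : 0 <= C `^ theta by exact: powR_ge0.
exists (tint (fun x => bracket (theta ^+ k.+2 * be0 / 2) (m0 x)) +
    K * C `^ theta * (2 `^ theta * (T + 1))).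
  by rewrite addr_ge0// !mulr_ge0// ?powR_ge0 ?addr_ge0// ltW.
move=> H u0 geps u m Fu Fm hH sol sFu sFm FuE FmE hy tau tauT.
have {}IH := IH H u0 geps u m Fu Fm hH sol sFu sFm FuE FmE hy.
have hae : {ae (lebesgue_itv 0 T), forall t : measurableTypeR R,
    tint (fun x => bracket (theta ^+ k.+1 * be0 / 2) (m x t)) <=
    C * (1 + pint 0 T (fun t => drift_norm H Fu p t `^ (gn_exponent n%:R q theta)^-1)
               `^ geom theta k.+1)}.
  by apply: filterS (ae_lebesgue_itv_mem 0 T) => t; exact: IH.
have := HK T H u0 m0 geps u m Fu Fm _ T0 hH sol sFu sFm FuE FmE hae tau tauT.
rewrite mulrA -exprS => /le_trans; apply.
move: (pint _ _ _) (rho0 H Fu) => rho r0.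
rewrite (geomS k.+1)//.
have s0 := geom_ge0 k.+1 t1.
move: (geom theta k.+1) s0 => s s0.
have H1 := step_algebra t1 s0 r0 T0.
have p1 a : 0 <= rho `^ a by exact: powR_ge0.
rewrite powRM ?addr_ge0// mulrDl lerD//; first by rewrite ler_peMr// lerDl.
by rewrite -!mulrA !ler_wpM2l// mulrA.
Qed.

End iteration.

(** * Comparison with the norms of the statement *)

Section norms.
Context {R : realType}.

(* No measurability is needed for monotonicity: the integral of a nonnegative
   function is a supremum over the simple functions below it. *)
Lemma ge0_le_integral_nonmeasurable d (X : measurableType d)
    (mu : {measure set X -> \bar R}) (f g : X -> \bar R) :
  (forall x, 0 <= f x)%E -> (forall x, f x <= g x)%E ->
  (\int[mu]_x f x <= \int[mu]_x g x)%E.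
Proof.
move=> f0 fg; have g0 x : (0 <= g x)%E by exact: le_trans (f0 x) (fg x).
rewrite !ge0_integralTE//; apply: le_ereal_sup => _ [h hf <-].
by exists h => // x; exact: le_trans (hf x) (fg x).
Qed.

(** From (s^2 + 1)^(1/2) <= 1 + |s| <= 2 max(1, |s|). *)
Lemma bracket_half_le (be s : R) : 0 <= be ->
  bracket (be / 2) s <= 2 `^ be * (1 + `|s| `^ be).
Proof.
move=> be0.
have p0 a : 0 <= `|s| `^ a by exact: powR_ge0.
have -> : 2 `^ be * (1 + `|s| `^ be) = 2 `^ be + (2 * `|s|) `^ be.
  by rewrite powRM// mulrDr mulr1.
have H1 : bracket (be / 2) s <= (1 + `|s|) `^ be.
  rewrite /bracket mulrC powRrM ge0_ler_powR ?nnegrE ?powR_ge0 ?addr_ge0//.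
  rewrite powR12_sqrt ?(ltW (sqrD1_gt0 s))//.
  rewrite -[leRHS]ger0_norm ?addr_ge0// -sqrtr_sqr ler_sqrt ?sqr_ge0//.
  rewrite -[s ^+ 2]real_normK ?num_real//; move: `|s| (normr_ge0 s) => y y0.
  nra.
apply: (le_trans H1); have [s1|s1] := leP `|s| 1.
  rewrite -[leLHS]addr0 lerD ?powR_ge0// ge0_ler_powR ?nnegrE ?addr_ge0//.
  by rewrite -[leRHS]/(1 + 1) lerD2l.
rewrite -[leLHS]add0r lerD ?powR_ge0// ge0_ler_powR ?nnegrE ?addr_ge0 ?mulr_ge0//.
by rewrite mulr_natl mulr2n lerD2r ltW.
Qed.

(* For [s < 0] the library sets [s `^ be = 1]. *)
Lemma powR_le_bracket (be s : R) : 0 <= be -> s `^ be <= bracket (be / 2) s.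
Proof.
move=> be0; have [s0|s0] := leP 0 s; last first.
  by rewrite lt0_powR1// bracket_ge1// divr_ge0.
have -> : s `^ be = (s ^+ 2) `^ (be / 2).
  by rewrite -powR_mulrn// -powRrM mulrCA divff ?mulr1.
by rewrite ge0_ler_powR ?nnegrE ?divr_ge0 ?sqr_ge0 ?(ltW (sqrD1_gt0 s))// lerDl.
Qed.

Context {n : nat}.
Local Notation V := 'rV[R]_n.

(** [M] carries no sign, and powers are compared on nonnegative reals; hence [Num.max M 0]. *)
Lemma tint_bracket_le (be M : R) (f : V -> R) : 0 < be -> continuous f ->
  (Lnorm (torus_measure n) be%:E (fun x => (f (vec x))%:E) <= M%:E)%E ->
  tint (fun x => bracket (be / 2) (f x)) <= 2 `^ be * (1 + Num.max M 0 `^ be).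
Proof.
move=> be0 cf; rewrite Lnorm_tint// lee_fin => fM.
have cfb : continuous (fun x => `|f x| `^ be).
  by apply: continuous_powR_ge0 => //; exact: continuous_normr.
have cf1 : continuous (fun x => 1 + `|f x| `^ be).
  by apply: continuous_addr => //; exact: continuous_constr.
apply: (@le_trans _ _ (tint (fun x => 2 `^ be * (1 + `|f x| `^ be)))).
  apply: le_tint; [exact: continuous_bracket| |].
    by apply: continuous_mulr => //; exact: continuous_constr.
  by move=> x; apply: bracket_half_le; exact: ltW.
rewrite tintZ// ler_wpM2l ?powR_ge0// tintD//; last exact: continuous_constr.
rewrite tint_cst lerD2l.
have I0 : 0 <= tint (fun x => `|f x| `^ be) by apply: tint_ge0 => x; exact: powR_ge0.
have -> : tint (fun x => `|f x| `^ be) = (tint (fun x => `|f x| `^ be) `^ be^-1) `^ be.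
  by rewrite -powRrM mulVf ?gt_eqF// powRr1.
by rewrite ge0_ler_powR ?nnegrE ?(ltW be0) ?powR_ge0// ?le_max ?lexx ?fM ?orbT.
Qed.

Lemma enorm_sqr (v : V) : enorm v ^+ 2 = \sum_i v 0 i ^+ 2.
Proof. by rewrite sqr_sqrtr// sumr_ge0// => i _; exact: sqr_ge0. Qed.

Lemma drift_norm_LtLx (T r p : R) (H : V -> V -> R) (u : V -> R -> R) (Fu : V * R -> R) :
  0 < T -> 0 < r -> 0 < p -> smooth (fun z : V * V => H z.1 z.2) -> smooth Fu ->
  continuous (drift_norm H Fu p) ->
  (forall x t, 0 <= t <= T -> Fu (x, t) = u x t) ->
  ((pint 0 T (fun t => drift_norm H Fu p t `^ r))%:E <=
   LtLx T r%:E p%:E (fun x t => (enorm (DpH H u x t) ^+ 2)%R) `^ r)%E.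
Proof.
move=> T0 r0 p0 sH sFu cd FuE.
have d0 t : 0 <= drift_norm H Fu p t by exact: powR_ge0.
have cdr : continuous (fun t => drift_norm H Fu p t `^ r) by exact: continuous_powR_ge0.
rewrite /LtLx poweR_Lnorm ?gt_eqF// pintE//.
have mdr : measurable_fun setT (fun t : R => (drift_norm H Fu p t `^ r)%:E).
  by apply/measurable_EFinP; exact: continuous_measurable_fun.
(* Outside [0, T] the extension is unrelated to u; cutting to 0 there gives a comparison at every
   [t]. *)
pose f := (fun t : R => (drift_norm H Fu p t `^ r)%:E) \_ `[0, T].
have f0 t : (0 <= f t)%E.
  by rewrite /f patchE; case: ifP => // _; rewrite lee_fin powR_ge0.
have mf : measurable_fun setT f.
  have mI : measurable (`[0, T]%classic : set R) by exact: measurable_itv.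
  apply/(measurable_restrictT _ mI); exact: (measurable_funS measurableT).
have -> : (\int[lebesgue_measure]_(t in `[0%R, T]) (drift_norm H Fu p t `^ r)%:E =
    \int[lebesgue_itv 0 T]_t f t)%E.
  rewrite ge0_integral_lebesgue_itv//; apply: eq_integral => t tT.
  by rewrite /f patchE tT.
apply: ge0_le_integral_nonmeasurable => // t.
rewrite /f patchE; case: ifPn => [|_]; last exact: poweR_ge0.
rewrite inE /= in_itv /= => tT.
have cs : continuous (fun x => \sum_i drift H Fu i (x, t) ^+ 2).
  apply: continuous_bigsum => i _.
  have := continuous_pair2 (s := t) (continuous_drift (i := i) sH sFu).
  by move=> ci; exact: continuous_mulr.
have -> : (fun x : n.-tuple R => (enorm (DpH H u (vec x) t) ^+ 2)%:E) =
    (fun x => (\sum_i drift H Fu i (vec x, t) ^+ 2)%:E).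
  apply/funext => x; rewrite enorm_sqr; congr EFin; apply: eq_bigr => i _.
  by rewrite (@DpH_drift _ _ H _ sFu)// => y; rewrite FuE.
have E : (fun x => `|\sum_i drift H Fu i (x, t) ^+ 2| `^ p) =
    (fun x => (\sum_i drift H Fu i (x, t) ^+ 2) `^ p).
  by apply/funext => x; rewrite ger0_norm// sumr_ge0// => i _; exact: sqr_ge0.
have := Lnorm_tint p0 cs; rewrite E -/(drift_norm H Fu p t) => ->.
by rewrite gee0_abs ?lee_fin// poweR_EFin.
Qed.

End norms.

Unset Implicit Arguments.

Theorem theorem1p2 (R : realType) (d : nat) (T : R) (m0 : 'rV[R]_d -> R)
    (p q theta beta0 M : R) (n : nat) :
  (2 < d)%N -> 0 < T ->
  smooth m0 -> zperiodic m0 -> (forall x, 0 <= m0 x) ->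
  (\int[torus_measure d]_x (m0 (vec x))%:E = 1)%E ->
  d%:R / 2 < p -> p^-1 + q^-1 = 1 -> 1 < theta -> 1 <= beta0 -> (1 <= n)%N ->
  let kappa := (d%:R + 2 * q - d%:R * q) / (q * ((theta - 1) * d%:R + 2)) in
  let r := kappa^-1 in
  let beta_n := theta ^+ n * beta0 in
  let r_n := r * ((theta ^+ n - 1) / (theta - 1)) in
  exists C : R,
    forall (H : 'rV[R]_d -> 'rV[R]_d -> R) (u0 : 'rV[R]_d -> R) (g : R -> R)
      (eta : 'rV[R]_d -> R) (eps : R) (u m : 'rV[R]_d -> R -> R),
    hamiltonian H ->
    smooth u0 -> zperiodic u0 ->
    mollifier eta -> 0 < eps ->
    mfg_solution T H u0 m0 (reg_coupling eta eps g) u m ->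
    (LtLx T +oo beta0%:E m <= M%:E)%E ->
    forall tau : R, 0 <= tau <= T ->
      (\int[torus_measure d]_x ((m (vec x) tau) `^ beta_n)%:E
       <= C%:E + C%:E *
          (LtLx T r%:E p%:E (fun x t => (enorm (DpH H u x t) ^+ 2)%R)) `^ r_n)%E.
Proof.
move=> d2 T0 sm0 pm0 m00 m01 dp pq t1 be01 n1 kappa r beta_n r_n.
have N2 : 2 < d%:R :> R by rewrite ltr_nat.
have [p0 q1 qd] := conjugate_exponent_bounds N2 dp pq.
have kE : kappa = gn_exponent d%:R q theta by [].
have k0 : 0 < kappa by rewrite kE; exact: gn_exponent_gt0 dp pq t1.
have r0 : 0 < r by rewrite invr_gt0.
pose y0 := 2 `^ beta0 * (1 + Num.max M 0 `^ beta0).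
case: n n1 @beta_n @r_n => // k _ beta_n r_n.
have [C C0 HC] := @bracket_iterate R d T p q theta beta0 y0 m0 k d2 T0 dp pq t1 be01.
exists C => H u0 g eta eps u m hH su0 pu0 meta eps0 sol Mm tau tauT.
have [[Fu sFu FuE] [Fm sFm FmE]] := mfg_smooth sol.
have be00 : 0 < beta0 by exact: lt_le_trans ltr01 be01.
have cm t : 0 <= t <= T -> continuous (m ^~ t).
  move=> tT; have -> : m ^~ t = (fun x => Fm (x, t)).
    by apply/funext => x; rewrite FmE.
  exact: (continuous_pair2 (s := t) (smooth_continuous sFm)).
have base : {ae (lebesgue_itv 0 T), forall t : measurableTypeR R,
    tint (fun x => bracket (beta0 / 2) (m x t)) <= y0}.
  move: Mm; rewrite /LtLx; set N := (X in Lnorm _ _ X); rewrite unlock.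
  (* The norm with exponent [+oo] is an essential supremum provided that the measure is nonzero,
     which T > 0 ensures. *)
  rewrite (_ : (0 < lebesgue_itv 0 T setT)%E = true); last first.
    by rewrite lebesgue_itvE setTI /= lebesgue_measure_itv /= lte_fin T0 -EFinB lte_fin subr0.
  move=> /ess_sup_inf.ess_supP H1.
  apply: filterS2 H1 (ae_lebesgue_itv_mem 0 T) => t; rewrite /= /N => + tT.
  by rewrite gee0_abs ?Lnorm_ge0// => H1; exact: tint_bracket_le (cm t tT) H1.
have {HC} := HC H u0 _ u m Fu Fm hH sol sFu sFm FuE FmE base tau tauT.
rewrite -kE -/r.
set rho := pint _ _ _ => Hrho.
have := drift_norm_LtLx T0 r0 p0 (hamiltonian_smooth hH) sFu
  (continuous_drift_norm hH sFu p0) FuE.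
rewrite -/rho; set L := LtLx _ _ _ _ => rhoL.
have rho0 : 0 <= rho by apply: Rintegral_ge0 => t _; exact: powR_ge0.
apply: (@le_trans _ _ (tint (fun x => bracket (beta_n / 2) (m x tau)))%:E).
  rewrite tintE; last exact: (continuous_bracket (cm tau tauT)).
  apply: ge0_le_integral_nonmeasurable => x; first by rewrite lee_fin powR_ge0.
  rewrite lee_fin powR_le_bracket// mulr_ge0 ?exprn_ge0//; first exact: ltW (lt_trans _ t1).
  exact: ltW.
apply: (@le_trans _ _ (C * (1 + rho `^ geom theta k.+1))%:E); first by rewrite lee_fin.
rewrite mulrDr mulr1 EFinD EFinM leeD2l// lee_wpmul2l ?lee_fin//.
(* Since rho <= L^r, the power L^(r_n) = (L^r)^(geom theta (k+1)) dominates the corresponding power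
   of rho, also when L is infinite. *)
rewrite /r_n poweRrM -poweR_EFin.
apply: gt0_ler_poweR => //; first exact: geom_ge0.
  by rewrite in_itv /= lee_fin rho0 leey.
by rewrite in_itv /= poweR_ge0 leey.
Qed.
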